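(* Let $a<b$ be real, let $1\le p\le\infty$ with $1/p+1/q=1$, and let $n\ge1$ be an integer. Let $x_i=a+(b-a)i/n$ for $0\le i\le n$. For every $f:[a,b]\to\mathbb{R}$ such that $f'$ is absolutely continuous on $[a,b]$ and $f''\in L^p([a,b])$, define $E(f)$ by $$\int_a^b f(x)\,dx=\frac{b-a}{2n}\left[f(a)+2\sum_{i=1}^{n-1}f(x_i)+f(b)\right]+\frac{(b-a)^2}{8n^2}\left(1-\beta_q^{-2}\right)\left[f'(a)-f'(b)\right]+E(f).$$ Then $$|E(f)|\le\begin{cases}\dfrac{\|f''\|_1(b-a)^2}{16n^2}, & p=1,\\[2mm] \dfrac{\|f''\|_p(b-a)^{2+1/q}\left(1-\beta_q^{-2}\right)}{2^{3+1/q}(q+1/2)^{1/q}\,n^2}, & 1<p<\infty,\\[2mm] \dfrac{\|f''\|_\infty(b-a)^3}{32n^2}, & p=\infty.\end{cases}$$ The coefficient of $\|f''\|_p$ in the error bound is the best possible (it cannot be replaced by any smaller constant valid for all such $f$).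
   Context: $\|\cdot\|_p$ is the $L^p([a,b])$ norm and $B$ is the beta function. The constants $\beta_q$ are: for $1<q<\infty$, $\beta_q>1$ is the unique solution of $\int_1^{\beta_q}(x^2-1)^{q-1}\,dx=\tfrac12B(q,1/2)$; $\beta_1=2$; and $\beta_\infty=\sqrt2$. *)

(* Defs.v *)
From HB Require Import structures.
From mathcomp Require Import all_boot all_order all_algebra.
From mathcomp Require Import all_classical all_reals all_analysis.

Set Implicit Arguments.
Unset Strict Implicit.
Unset Printing Implicit Defensive.

Import Order.TTheory GRing.Theory Num.Theory.
Import numFieldNormedType.Exports.

Local Open Scope classical_set_scope.
Local Open Scope ring_scope.

(* The library's [beta_fun] takes natural arguments only.  At t = 0 and t = 1
   a negative power evaluates to 0 instead of being undefined, which does not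
   affect the integral. *)
Definition euler_beta (R : realType) (x y : R) : R :=
  \int[lebesgue_measure]_(t in `[0, 1]) (t `^ (x - 1) * (1 - t) `^ (y - 1)).

(* The value at q < 1, for which beta_q is not defined, is irrelevant. *)
Definition beta_const (R : realType) (q : \bar R) : R :=
  match q with
  | r%:E =>
      if r == 1 then 2
      else xget 0 [set beta : R | 1 < beta /\
        \int[lebesgue_measure]_(x in `[1, beta]) ((x ^+ 2 - 1) `^ (r - 1))
          = 2^-1 * euler_beta r 2^-1]
  | +oo%E => Num.sqrt 2
  | -oo%E => 0
  end.

(* g, seen as a function on [a, b] only, has derivative l at x: the derivative
   is one-sided when x is a or b. *)
Definition has_deriv_on (R : realType) (a b : R) (g : R -> R) (x l : R) : Prop :=
  (g y - g x) / (y - x) @[y --> within `[a, b] x^'] --> l.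

Definition abs_continuous_on (R : realType) (a b : R) (g : R -> R) : Prop :=
  forall e : R, 0 < e -> exists2 d : R, 0 < d &
    forall (m : nat) (s t : 'I_m -> R),
      (forall i, a <= s i /\ s i <= t i /\ t i <= b) ->
      trivIset setT (fun i => `]s i, t i[%classic) ->
      \sum_(i < m) (t i - s i) < d ->
      \sum_(i < m) `|g (t i) - g (s i)| < e.

(* f' and f'' are the first and second derivatives of f on [a, b].  The latter
   is an element of L^p([a, b]): f'' is any Borel representative of the almost
   everywhere defined derivative of f'. *)
Definition admissible (R : realType) (a b : R) (p : \bar R)
    (f f' f'' : R -> R) : Prop :=
  [/\ forall x, x \in `[a, b] -> has_deriv_on a b f x (f' x),
      abs_continuous_on a b f',
      {ae (@lebesgue_measure R),
        forall x, x \in `[a, b] -> has_deriv_on a b f' x (f'' x)} &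
      f'' \_ `[a, b] \in Lfun (@lebesgue_measure R) p].

Definition norm_on (R : realType) (a b : R) (p : \bar R) (g : R -> R) : \bar R :=
  'N[@lebesgue_measure R]_p[EFin \o (g \_ `[a, b])]%E.

Definition quad_node (R : realType) (a b : R) (n i : nat) : R :=
  a + (b - a) * i%:R / n%:R.

Definition quad_error (R : realType) (a b : R) (q : \bar R) (n : nat)
    (f f' : R -> R) : R :=
  (\int[lebesgue_measure]_(x in `[a, b]) f x)
  - ((b - a) / (2 * n%:R)
       * (f a + 2 * \sum_(1 <= i < n) f (quad_node a b n i) + f b)
     + (b - a) ^+ 2 / (8 * n%:R ^+ 2)
       * (1 - (beta_const q) ^- 2) * (f' a - f' b)).

Definition error_coef (R : realType) (a b : R) (p q : \bar R) (n : nat) : R :=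
  if p == 1%E then (b - a) ^+ 2 / (16 * n%:R ^+ 2)
  else if p == +oo%E then (b - a) ^+ 3 / (32 * n%:R ^+ 2)
  else let r := fine q in
    (b - a) `^ (2 + r^-1) * (1 - (beta_const q) ^- 2)
    / (2 `^ (3 + r^-1) * (r + 2^-1) `^ r^-1 * n%:R ^+ 2).

(* Main.v *)
Require Import Defs.
From HB Require Import structures.
From mathcomp Require Import all_boot all_order all_algebra.
From mathcomp Require Import all_classical all_reals all_analysis.
From mathcomp Require Import measurable_realfun ess_sup_inf ring lra.
Import Order.TTheory GRing.Theory Num.Theory.
Import numFieldNormedType.Exports.
Local Open Scope classical_set_scope.
Local Open Scope ring_scope.

(** Integrating by parts twice on each subinterval gives E(f) = int K f'', where
    K(x) = ((x - m)^2 - (h / beta_q)^2) / 2 on the subinterval with midpoint m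
    and half-length h = (b - a) / (2 n). Since f' is only absolutely continuous,
    this is the Lebesgue form of the fundamental theorem of calculus, applied to
    K f' - K' f. Hoelder's inequality then bounds |E(f)| by ||K||_q ||f''||_p,
    and the coefficient of the statement is ||K||_q: the equation defining
    beta_q says that int sgn(K) |K|^(q-1) = 0, so that (x - m) |K|^q is, up to
    a term of zero integral, a primitive of (2 q + 1) |K|^q. The constant is
    optimal already for continuous f'': take sgn(K) |K|^(q-1) if 1 < p < oo,
    K / (|K| + d) with d -> 0 if p = oo, and a narrow peak at a, where |K| is
    maximal, if p = 1. *)

(** * Derivatives on a segment and absolute continuity *)

Section one_sided_derivatives.
Set Implicit Arguments.
Unset Strict Implicit.
Variable R : realType.
Implicit Types (a b l r x : R) (f g h : R -> R).

(** Any constant in place of [(h / beta_q)^2] would give an exact formula too, with another multiple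
    of f'(a) - f'(b). The derivative of [int |K|^q] with respect to that constant is a multiple of
    [int sgn(K) |K|^(q-1)], so for 1 < q < oo the equation defining beta_q singles out the kernel of
    least q-norm. For q = oo the value sqrt 2 makes the extreme values of K opposite; for q = 1 the
    value 2 makes K positive and negative on sets of equal length. The main obstacle is to recover
    an absolutely continuous function from its almost everywhere derivative. In place of a Vitali
    covering, the exceptional null set is put into an open set of small measure, and Cousin's lemma
    chains local estimates from one end of the segment to the other. The primitive of the signed
    power in the equation for beta_q is never computed: all that matters is that it takes the same
    value at beta_q and -beta_q. *)

Lemma slope_subE (u d k : R) : k != 0 -> (u - d * k) / k = u / k - d.
Proof. by move=> k0; rewrite mulrBl mulfK. Qed.

(** Multiplying out the difference quotient removes the division and the exclusion of [y = x].
    One-sided and two-sided derivatives then differ only in the range of [y]. *)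
Lemma has_deriv_onP a b g x d : has_deriv_on a b g x d <->
  forall e : R, 0 < e -> exists2 k : R, 0 < k & forall y, a <= y <= b -> `|y - x| < k ->
    `|g y - g x - d * (y - x)| <= e * `|y - x|.
Proof.
rewrite /has_deriv_on; split.
  move/cvgrPdist_lt => H e e0; have := H e e0.
  rewrite /within /dnbhs /= => /nbhs_ballP[k /= k0 Hk].
  exists k => // y yab yx.
  have [->|xy] := eqVneq y x; first by rewrite !subrr mulr0 subrr normr0 mulr0.
  have xy' : y - x != 0 by rewrite subr_eq0.
  have := Hk y; rewrite /ball/= in_itv/= distrC => /(_ yx xy yab)/ltW.
  rewrite -ler_pdivrMr ?normr_gt0// -normf_div distrC.
  by rewrite slope_subE.
move=> H; apply/cvgrPdist_le => e e0; have [k k0 Hk] := H e e0.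
rewrite /within /dnbhs /=; apply/nbhs_ballP; exists k => //= y xy yx yab.
have xy' : y - x != 0 by rewrite subr_eq0.
rewrite in_itv/= in yab; rewrite /ball/= distrC in xy.
have := Hk y yab xy.
by rewrite -ler_pdivrMr ?normr_gt0// -normf_div distrC slope_subE.
Qed.

Lemma is_deriveP g x d : is_derive x 1 g d <->
  forall e : R, 0 < e -> exists2 k : R, 0 < k & forall y, `|y - x| < k ->
    `|g y - g x - d * (y - x)| <= e * `|y - x|.
Proof.
split.
  move=> [dg /esym dE] e e0.
  have /cvg_ex[d' dd] := dg.
  have dd' : d' = d by rewrite dE /derive; apply/esym/cvg_lim.
  rewrite {}dd' in dd.
  move/cvgrPdist_lt: dd => /(_ e e0); rewrite /dnbhs/within/= => /nbhs_ballP[k/= k0 Hk].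
  exists k => // y yx.
  have [->|xy] := eqVneq y x; first by rewrite !subrr mulr0 subrr normr0 mulr0.
  have xy' : y - x != 0 by rewrite subr_eq0.
  have := Hk (y - x); rewrite /ball/= sub0r normrN => /(_ yx xy')/ltW.
  rewrite -ler_pdivrMr ?normr_gt0// -normf_div distrC.
  by rewrite /GRing.scale/= mulr1 subrK slope_subE// [_^-1 * _]mulrC.
move=> H.
have C : (fun h : R => h^-1 *: (g (h *: 1 + x) - g x)) @ 0^' --> d.
  apply/cvgrPdist_le => e e0; have [k k0 Hk] := H e e0.
  rewrite /dnbhs/within/=; apply/nbhs_ballP; exists k => //= y.
  rewrite /ball/= sub0r normrN => yk y0.
  have := Hk (y + x); rewrite addrK => /(_ yk).
  rewrite -ler_pdivrMr ?normr_gt0// -normf_div distrC.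
  by rewrite /GRing.scale/= mulr1 slope_subE// [_^-1 * _]mulrC.
split; first by apply/cvg_ex; exists d.
by rewrite /derive; apply/cvg_lim.
Qed.

Lemma has_deriv_on_interior a b g x d : a < x < b ->
  has_deriv_on a b g x d -> is_derive x 1 g d.
Proof.
move=> /andP[ax xb] /has_deriv_onP H; apply/is_deriveP => e /H[k k0 Hk].
exists (Num.min k (Num.min (x - a) (b - x))).
  by rewrite !lt_min k0 !subr_gt0 ax.
move=> y; rewrite !lt_min => /and3P[yk ya yb]; apply: Hk => //.
move: ya yb; rewrite !ltr_norml => /andP[? ?] /andP[? ?]; lra.
Qed.

Lemma is_derive_has_deriv_on a b g x d : is_derive x 1 g d -> has_deriv_on a b g x d.
Proof.
move=> /is_deriveP H; apply/has_deriv_onP => e /H[k k0 Hk].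
by exists k => // y _; exact: Hk.
Qed.

Lemma abs_continuous_on_continuous a b g : abs_continuous_on a b g ->
  {within `[a, b], continuous g}.
Proof.
move=> ac; apply/subspace_continuousP => x; rewrite /= in_itv/= => xab.
apply/cvgrPdist_lt => e e0; have [k k0 Hk] := ac e e0.
rewrite /within/=; apply/nbhs_ballP; exists k => //= y yx; rewrite in_itv/= => yab.
pose s (i : 'I_1) := Num.min x y; pose t (i : 'I_1) := Num.max x y.
have := Hk 1%N s t; rewrite !big_ord1 /s /t.
rewrite /ball/= in yx.
case: (leP x y) => xy.
  rewrite [`|g x - g y|]distrC; apply.
  - by move=> i; move/andP: xab => []; move/andP: yab => [].
  - by move=> i j _ _ _; apply: val_inj; rewrite /= !ord1.
  - by rewrite distrC ger0_norm ?subr_ge0 in yx.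
apply.
- by move=> i; move/andP: xab => []; move/andP: yab => []; rewrite (ltW xy).
- by move=> i j _ _ _; apply: val_inj; rewrite /= !ord1.
- by rewrite ger0_norm ?subr_ge0 ?ltW in yx.
Qed.

Lemma segment_bounded a b g : {within `[a, b], continuous g} ->
  exists2 M, 0 < M & forall x, a <= x <= b -> `|g x| <= M.
Proof.
move=> cg; have /compact_bounded[M [_ HM]] :=
  @continuous_compact _ _ g _ cg (@segment_compact R a b).
exists (Num.max 1 (M + 1)); first by rewrite lt_max ltr01.
move=> x xab; apply: HM; first by rewrite lt_max ltrDl ltr01 orbT.
by exists x => //=; rewrite in_itv.
Qed.

Lemma abs_continuous_on_lipschitz a b g (M : R) : 0 < M ->
  (forall x y, a <= x -> x <= y -> y <= b -> `|g y - g x| <= M * (y - x)) ->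
  abs_continuous_on a b g.
Proof.
move=> M0 lip e e0; exists (e / M); first by rewrite divr_gt0.
move=> m s t st _ len; rewrite ltr_pdivlMr// mulrC mulr_sumr in len.
apply: le_lt_trans len; apply: ler_sum => i _.
by have [? [? ?]] := st i; exact: lip.
Qed.

Lemma abs_continuous_onB a b f g : abs_continuous_on a b f -> abs_continuous_on a b g ->
  abs_continuous_on a b (fun x => f x - g x).
Proof.
move=> cf cg e e0; have e2 : 0 < e / 2 by rewrite divr_gt0.
have [k k0 Hk] := cf _ e2; have [k' k0' Hk'] := cg _ e2.
exists (Num.min k k'); first by rewrite lt_min k0.
move=> m s t st tr; rewrite lt_min => /andP[lk lk'].
rewrite [e]splitr; apply: le_lt_trans (ltrD (Hk m s t st tr lk) (Hk' m s t st tr lk')).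
rewrite -big_split/=; apply: ler_sum => i _.
have -> : f (t i) - g (t i) - (f (s i) - g (s i)) =
  (f (t i) - f (s i)) - (g (t i) - g (s i)) by ring.
exact: ler_normB.
Qed.

Lemma abs_continuous_onM a b f g : abs_continuous_on a b f -> abs_continuous_on a b g ->
  abs_continuous_on a b (fun x => f x * g x).
Proof.
move=> cf cg.
have [M M0 HM] := segment_bounded (abs_continuous_on_continuous cf).
have [N N0 HN] := segment_bounded (abs_continuous_on_continuous cg).
move=> e e0; have eN : 0 < e / 2 / N by rewrite !divr_gt0.
have eM : 0 < e / 2 / M by rewrite !divr_gt0.
have [k k0 Hk] := cf _ eN; have [k' k0' Hk'] := cg _ eM.
exists (Num.min k k'); first by rewrite lt_min k0.
move=> m s t st tr; rewrite lt_min => /andP[lk lk'].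
have H1 := Hk m s t st tr lk; have H2 := Hk' m s t st tr lk'.
rewrite ltr_pdivlMr// in H1; rewrite ltr_pdivlMr// in H2.
rewrite [e]splitr; apply: le_lt_trans (ltrD H1 H2).
rewrite !mulr_suml -big_split/=; apply: ler_sum => i _.
have [as_ [st_ tb]] := st i.
have -> : f (t i) * g (t i) - f (s i) * g (s i) =
  (f (t i) - f (s i)) * g (t i) + (g (t i) - g (s i)) * f (s i) by ring.
apply: le_trans (ler_normD _ _) _; rewrite !normrM; apply: lerD.
  by apply: ler_wpM2l => //; apply: HN; rewrite tb andbT (le_trans as_).
by apply: ler_wpM2l => //; apply: HM; rewrite as_/= (le_trans _ tb).
Qed.

Lemma abs_continuous_onS a b l r g : a <= l -> r <= b ->
  abs_continuous_on a b g -> abs_continuous_on l r g.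
Proof.
move=> al rb ac e /ac[k k0 Hk]; exists k => // m s t st; apply: Hk => i.
have [? [? ?]] := st i; split; [exact: le_trans al _|split=> //].
exact: le_trans rb.
Qed.

End one_sided_derivatives.

(** * The fundamental theorem of calculus for absolutely continuous functions *)

Section lebesgue_ftc.
Set Implicit Arguments.
Unset Strict Implicit.
Variable R : realType.
Implicit Types (a b l r x : R) (f g h : R -> R).
Notation mu := (@lebesgue_measure R).

Lemma open_measurableR (U : set R) : open U -> measurable (U : set (measurableTypeR R)).
Proof. exact: measurable_realfun.open_measurable. Qed.

(* Cousin's lemma, as an induction principle over an interval. *)
Lemma interval_gauge_induction l r (S : R -> Prop) : l <= r -> S l ->
  (forall c, l <= c <= r -> exists2 k : R, 0 < k & forall x y,
     l <= x -> x <= c -> c <= y -> y <= r -> c - k < x -> y < c + k -> S x -> S y) ->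
  S r.
Proof.
move=> lr Sl step; pose E := [set x | l <= x <= r /\ S x].
have El : E l by split => //; rewrite lexx.
have supE : has_sup E by split; [exists l|exists r => x [/andP[]]].
set c := sup E.
have lc : l <= c by apply: ub_le_sup => //; case: supE.
have cr : c <= r by apply: ge_sup; [exists l|move=> x [/andP[]]].
have [|k k0 Hk] := step c; first by rewrite lc.
have [x [/andP[lx xr] Sx] cx] := sup_adherent k0 supE.
have xc : x <= c by apply: ub_le_sup; [case: supE|split => //; rewrite lx].
(* [S] propagates half a gauge past the supremum unless [r] is in the way, so the supremum can only
   be [r]. *)
pose y := Num.min (c + k / 2) r.
have cy : c <= y by rewrite le_min cr andbT lerDl divr_ge0// ltW.
have yr : y <= r by rewrite ge_min lexx orbT.
have Sy : S y.
  apply: (Hk x) => //.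
  by rewrite gt_min ltrD2l ltr_pdivrMr// mulr_natr mulr2n ltrDl k0.
have yc : y <= c.
  apply: ub_le_sup; first by case: supE.
  by split => //; rewrite yr (le_trans lc).
have -> : r = y; last by [].
move: yc; rewrite /y ge_min => /orP[|rc]; first by rewrite gerDl leNgt divr_gt0.
by apply/esym/min_idPr; rewrite (le_trans rc)// lerDl divr_ge0// ltW.
Qed.

Lemma measure_disjoint_intervals (m : nat) (s t : 'I_m -> R) :
  (forall i, s i <= t i) -> trivIset setT (fun i => `]s i, t i[%classic) ->
  mu (\big[setU/set0]_(i < m) `]s i, t i[%classic) = (\sum_(i < m) (t i - s i))%:E.
Proof.
move=> st tr; rewrite measure_bigsetU_ord//= -sumEFin; apply: eq_bigr => i _.
rewrite lebesgue_measure_itv/= lte_fin; case: ltP => // ts.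
by have /eqP <- : s i == t i by [rewrite eq_le st]; rewrite subrr.
Qed.

Lemma sum_lengths_le_measure (m : nat) (s t : 'I_m -> R) (U : set R) :
  measurable U -> (forall i, s i <= t i) ->
  trivIset setT (fun i => `]s i, t i[%classic) ->
  (forall i, `]s i, t i[ `<=` U) ->
  ((\sum_(i < m) (t i - s i))%:E <= mu U)%E.
Proof.
move=> mU st tr sU; rewrite -measure_disjoint_intervals//.
apply: le_measure; rewrite ?inE//; first exact: bigsetU_measurable.
by elim/big_ind: _ => // A B AU BU x [/AU|/BU].
Qed.

Lemma null_set_cover (D : set R) (k : R) : mu.-negligible D -> 0 < k ->
  exists U, [/\ open U, D `<=` U & (mu U < k%:E)%E].
Proof.
move=> [N [mN N0 DN]] k0.
have [|U [oU NU UN]] := lebesgue_regularity_outer mN _ k0; first by rewrite [X in (X < _)%E]N0.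
exists U; split => //; first exact: subset_trans NU.
rewrite (measureDI _ (open_measurableR oU) mN) [X in (_ + X)%E](_ : _ = 0%E) ?adde0//.
apply/eqP; rewrite -measure_le0 -[X in (_ <= X)%E]N0; apply: le_measure; rewrite ?inE//.
by apply: measurableI => //; exact: open_measurableR.
Qed.

(** Gauge induction walks from [l] to [r]. A step around a point of zero derivative costs at most
    [e'] times its length; a step around an exceptional point stays inside an open set of measure
    less than [k], so absolute continuity bounds all such steps together by [e']. *)
Lemma abs_continuous_on_zero_deriv l r h : l < r -> abs_continuous_on l r h ->
  {ae mu, forall x, l < x < r -> is_derive x 1 h 0} -> h r = h l.
Proof.
move=> lr ac dh0; apply/eqP; rewrite -subr_eq0 -normr_le0; apply/ler_addgt0Pl => e e0.
rewrite addr0; pose e' := e / (r - l + 1).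
have rl1 : 0 < r - l + 1 by rewrite addr_gt0// subr_gt0.
have e'0 : 0 < e' by rewrite divr_gt0.
have [k k0 Hk] := ac _ e'0.
(* The endpoints join the exceptional set because the derivative is known in the open interval
   only. *)
pose D := (~` [set x | l < x < r -> is_derive x 1 h 0]) `|` ([set l] `|` [set r]).
have nD : mu.-negligible D.
  apply: negligibleU; first exact: dh0.
  by apply: negligibleU; apply/negligibleP => //; exact: lebesgue_measure_set1.
have [U [oU DU Uk]] := null_set_cover nD k0.
(* [s] records, from right to left, the intervals inside [U] that were stepped over; their
   increments are kept aside instead of being estimated one by one. *)
pose S x := exists s : seq (R * R),
  [/\ forall p, p \in s -> [/\ l <= p.1, p.1 <= p.2, p.2 <= x & `]p.1, p.2[ `<=` U],
      pairwise (fun p q : R * R => q.2 <= p.1) s &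
      `|h x - h l| <= e' * (x - l) + \sum_(p <- s) `|h p.2 - h p.1|].
have : S r.
  apply: (@interval_gauge_induction l r) (ltW lr) _ _.
    by exists [::]; split => //; rewrite big_nil !subrr normr0 mulr0 addr0.
  move=> c /andP[lc cr].
  have [cU|cU] := pselect (U c).
    have /nbhs_ballP[j /= j0 Hj] : nbhs c U by apply: open_nbhs_nbhs.
    exists j => // x y lx xc cy yr jx yj [s [s1 s2 s3]].
    exists ((x, y) :: s); split.
    - move=> p; rewrite inE => /predU1P[->/=|/s1[? ? px ?]].
        split => //; first exact: le_trans cy.
        move=> z/=; rewrite in_itv/= => /andP[xz zy].
        by apply: Hj; rewrite /ball/= ltr_norml; apply/andP; split; lra.
      by split => //; apply: le_trans px _; exact: le_trans cy.
    - rewrite /= s2 andbT; apply/allP => p /s1[].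
      by [].
    - rewrite big_cons/=.
      have -> : h y - h l = (h y - h x) + (h x - h l) by ring.
      apply: le_trans (ler_normD _ _) _.
      have : e' * (x - l) <= e' * (y - l) by rewrite ler_pM2l//; lra.
      by move: s3; lra.
  have lcr : l < c < r.
    rewrite !lt_neqAle lc cr !andbT; apply/andP; split.
      by apply/eqP => lc'; apply: cU; apply: DU; right; left.
    by apply/eqP => lc'; apply: cU; apply: DU; right; right.
  have dc : is_derive c 1 h 0.
    by apply: contrapT => nd; apply: cU; apply: DU; left => /= /(_ lcr).
  have [j j0 Hj] := (is_deriveP h c 0).1 dc _ e'0.
  exists j => // x y lx xc cy yr jx yj [s [s1 s2 s3]].
  exists s; split => //.
    by move=> p /s1[? ? px ?]; split => //; apply: le_trans px _; exact: le_trans cy.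
  have := Hj x; have := Hj y.
  rewrite !mul0r !subr0 ger0_norm ?subr_ge0// [`|x - c|]ler0_norm ?subr_le0//.
  rewrite opprB => Hy Hx.
  have {}Hy : `|h y - h c| <= e' * (y - c) by apply: Hy; lra.
  have {}Hx : `|h x - h c| <= e' * (c - x) by apply: Hx; lra.
  (* The increment is split at the tag [c], whose derivative estimate covers both sides. *)
  have -> : h y - h l = (h y - h c) - (h x - h c) + (h x - h l) by ring.
  apply: le_trans (ler_normD _ _) _.
  have := ler_normB (h y - h c) (h x - h c).
  have -> : e' * (y - l) = e' * (y - c) + e' * (c - x) + e' * (x - l) by ring.
  move: Hx Hy s3; lra.
move=> [s [s1 s2 s3]].
pose u (i : 'I_(size s)) := (nth (0, 0) s i).1.
pose v (i : 'I_(size s)) := (nth (0, 0) s i).2.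
have Hs i : [/\ l <= u i, u i <= v i, v i <= r & `]u i, v i[ `<=` U].
  by apply: s1; rewrite mem_nth.
have tr : trivIset setT (fun i => `]u i, v i[%classic).
  have key (i j : 'I_(size s)) x : (i < j)%N ->
      `]u i, v i[%classic x -> `]u j, v j[%classic x -> False.
    move=> ij; rewrite /= !in_itv/= => /andP[ux _] /andP[_ xv].
    move/(pairwiseP (0, 0)): s2 => /(_ i j); rewrite !inE !ltn_ord => /(_ isT isT ij).
    by rewrite leNgt => /negP; apply; exact: lt_trans xv.
  move=> i j _ _ [x [xi xj]]; apply: val_inj => /=.
  case: (ltngtP i j) => // ij; first by case: (key _ _ _ ij xi xj).
  by case: (key _ _ _ ij xj xi).
have := Hk _ u v _ tr _.
have len : \sum_(i < size s) (v i - u i) < k.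
  rewrite -lte_fin; apply: le_lt_trans Uk; apply: sum_lengths_le_measure => //.
  - exact: open_measurableR.
  - by move=> i; have [] := Hs i.
  - by move=> i; have [] := Hs i.
move=> /(_ _ len) Hv.
apply: le_trans s3 _.
have -> : \sum_(p <- s) `|h p.2 - h p.1| = \sum_(i < size s) `|h (v i) - h (u i)|.
  by rewrite (big_nth (0, 0)) big_mkord.
have -> : e = e' * (r - l) + e' by rewrite /e'; field; rewrite gt_eqF.
by rewrite lerD2l; apply/ltW/Hv => i; have [] := Hs i.
Qed.

(** By Lebesgue differentiation the indefinite integral [G] of [psi] has derivative [psi] almost
    everywhere, and it is absolutely continuous; so [h - G] falls under
    [abs_continuous_on_zero_deriv]. *)
Lemma abs_continuous_on_FTC l r h (psi : R -> R) : l < r -> abs_continuous_on l r h ->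
  mu.-integrable `[l, r] (EFin \o psi) ->
  {ae mu, forall x, l < x < r -> is_derive x 1 h (psi x)} ->
  \int[mu]_(x in `[l, r]) psi x = h r - h l.
Proof.
move=> lr ac ipsi dh.
(* Extension by zero makes [psi] integrable on the whole line, so that [G] can be based at -oo as in
   [FTC1Ny]. *)
pose f := psi \_ `[l, r].
have intf : mu.-integrable setT (EFin \o f).
  by rewrite /f -restrict_EFin; apply/integrable_restrict => //; rewrite setTI.
have intfS D : measurable D -> mu.-integrable D (EFin \o f).
  by move=> mD; apply: integrableS intf.
pose G x := \int[mu]_(t in `]-oo, x]) f t.
have GB x y : x <= y -> G y - G x = \int[mu]_(t in `]x, y]) f t.
  by move=> xy; rewrite /G Rintegral_itvB//; exact: intfS.
(* The integral of [|f|] over a set is small when the measure of the set is; this is applied to the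
   union of the disjoint intervals. *)
have acG : abs_continuous_on l r G.
  move=> e e0; have [k [k0 Hk]] := integral_normr_continuous intf e0.
  exists k => // m s t st tr len.
  pose F i := `]s i, t i[%classic.
  have mF : measurable (\big[setU/set0]_(i < m) F i).
    by apply: bigsetU_measurable => i _; exact: measurable_itv.
  have muF : (mu (\big[setU/set0]_(i < m) F i) < k%:E)%E.
    rewrite measure_disjoint_intervals ?lte_fin// => i.
    by have [_ []] := st i.
  apply: le_lt_trans (Hk _ mF muF).
  rewrite /Rintegral integral_bigsetU_EFin; last 4 first.
  - by move=> i; exact: measurable_itv.
  - by rewrite index_enum_uniq.
  - by apply: sub_trivIset tr.
  - exact: (measurable_int _ (integrable_norm (intfS _ mF))).
  rewrite -sum_fine; last first.
    move=> i _; apply: integrable_fin_num; first exact: measurable_itv.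
    exact: integrable_norm (intfS _ (measurable_itv _)).
  apply: ler_sum => i _; have [_ [? _]] := st i.
  rewrite GB// -Rintegral_itv_bndo_bndc; last exact: intfS.
  by apply: le_normr_Rintegral => //; exact: intfS.
have dG : {ae mu, forall x, derivable G x 1 /\ (G^`()%classic) x = f x}.
  apply: FTC1Ny; first by move=> y; exact: intfS.
  exact: integrable_locally.
have : (fun x => h x - G x) r = (fun x => h x - G x) l.
  apply: (@abs_continuous_on_zero_deriv l r (fun x => h x - G x)) => //.
    exact: abs_continuous_onB.
  have aeF : Filter (nbhs (almost_everywhere mu)) := ae_filter_ringOfSetsType mu.
  apply: filterS2 dh dG => x dh [dG GE] lxr.
  have -> : 0 = psi x - f x.
    by rewrite /f patchE mem_set ?subrr//= in_itv/=; case/andP: lxr => /ltW -> /ltW ->.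
  apply: is_deriveB; first exact: dh.
  by apply: DeriveDef; [exact: dG|rewrite -derive1E; exact: GE].
move=> /= hG; have -> : h r - h l = G r - G l.
  by move: hG; lra.
rewrite GB; last exact: ltW.
rewrite -Rintegral_itv_obnd_cbnd; last first.
  by apply: integrableS ipsi => //; exact: subset_itv_oc_cc.
apply: eq_Rintegral => x; rewrite inE/= in_itv/= => /andP[lx xr].
by rewrite /f patchE mem_set//= in_itv/= (ltW lx).
Qed.

End lebesgue_ftc.

(** * The integral representation of the quadrature error *)

Section kernel_on_subinterval.
Set Implicit Arguments.
Unset Strict Implicit.
Variable R : realType.
Implicit Types (a b l r x : R) (f g h : R -> R).
Notation mu := (@lebesgue_measure R).

Lemma integrable_continuous a b f : {within `[a, b], continuous f} ->
  mu.-integrable `[a, b] (EFin \o f).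
Proof. by move=> cf; apply: continuous_compact_integrable => //; exact: segment_compact. Qed.

Lemma integrable_continuousM a b f g : {within `[a, b], continuous f} ->
  mu.-integrable `[a, b] (EFin \o g) ->
  mu.-integrable `[a, b] (EFin \o (fun x => f x * g x)).
Proof.
move=> cf ig; apply: (@integrableMr _ _ _ mu _ _ f (EFin \o g)) => //.
  by have /measurable_int/measurable_EFinP := integrable_continuous cf.
have [M M0 HM] := segment_bounded cf.
exists M; split; first exact: num_real.
move=> y My x /=; rewrite in_itv/= => xab; apply: le_trans (ltW My); exact: HM.
Qed.

Lemma has_deriv_on_continuous a b f f' :
  (forall x, x \in `[a, b] -> has_deriv_on a b f x (f' x)) ->
  {within `[a, b], continuous f}.
Proof.
move=> df; apply/subspace_continuousP => x; rewrite /= => xab.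
have /has_deriv_onP H := df x xab.
have [k k0 Hk] := H 1 ltr01.
pose M := 1 + `|f' x|; have M0 : 0 < M by rewrite /M ltr_pwDl.
apply/cvgrPdist_le => e e0; rewrite /within/=; apply/nbhs_ballP.
exists (Num.min k (e / M)); first by rewrite /= lt_min k0 divr_gt0.
move=> y; rewrite /ball/= lt_min in_itv/= distrC => /andP[yk ye] yab.
have := Hk y yab yk; rewrite mul1r => Hy.
have -> : f x - f y = - ((f y - f x - f' x * (y - x)) + f' x * (y - x)) by ring.
rewrite normrN; apply: le_trans (ler_normD _ _) _; rewrite normrM.
rewrite ltr_pdivlMr// mulrC in ye.
move: ye; rewrite /M mulrDl mul1r; lra.
Qed.

Lemma has_deriv_on_lipschitz a b f f' (M : R) :
  (forall x, x \in `[a, b] -> has_deriv_on a b f x (f' x)) ->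
  (forall x, a <= x <= b -> `|f' x| <= M) ->
  forall x y, a <= x -> x <= y -> y <= b -> `|f y - f x| <= M * (y - x).
Proof.
move=> df HM x y ax; rewrite le_eqVlt => /predU1P[<- _|xy yb].
  by rewrite !subrr normr0 mulr0.
have cf := has_deriv_on_continuous df.
have [||c] := @MVT R f f' x y xy.
- move=> z; rewrite in_itv/= => /andP[xz zy].
  apply: (@has_deriv_on_interior _ a b).
    by rewrite (le_lt_trans ax xz) (lt_le_trans zy yb).
  by apply: df; rewrite in_itv/= (ltW (le_lt_trans ax xz)) (ltW (lt_le_trans zy yb)).
- by apply: continuous_subspaceW cf; apply: subset_itv; rewrite bnd_simp.
rewrite in_itv/= => /andP[xc cy] ->; have xy0 : 0 <= y - x by rewrite subr_ge0 ltW.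
rewrite normrM (ger0_norm xy0); apply: ler_wpM2r => //.
by apply: HM; rewrite (ltW (le_lt_trans ax xc)) (ltW (lt_le_trans cy yb)).
Qed.

Lemma has_deriv_onS a b l r f x (d : R) : a <= l -> r <= b ->
  has_deriv_on a b f x d -> has_deriv_on l r f x d.
Proof.
move=> al rb /has_deriv_onP H; apply/has_deriv_onP => e /H[k k0 Hk].
exists k => // y /andP[ly yr]; apply: Hk.
by rewrite (le_trans al ly) (le_trans yr rb).
Qed.

(* [f'' * P - f] is the almost everywhere derivative of [f' * P - f * P']. *)
Lemma integral_quadratic_kernel l r (m k : R) f f' f'' : l < r ->
  (forall x, x \in `[l, r] -> has_deriv_on l r f x (f' x)) ->
  abs_continuous_on l r f' ->
  {ae mu, forall x, x \in `[l, r] -> has_deriv_on l r f' x (f'' x)} ->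
  mu.-integrable `[l, r] (EFin \o f'') ->
  \int[mu]_(x in `[l, r]) (((x - m) ^+ 2 - k) / 2 * f'' x) =
    \int[mu]_(x in `[l, r]) f x
    + (((r - m) ^+ 2 - k) / 2 * f' r - (r - m) * f r)
    - (((l - m) ^+ 2 - k) / 2 * f' l - (l - m) * f l).
Proof.
move=> lr df acf' df' if''.
pose P (x : R) := ((x - m) ^+ 2 - k) / 2.
have dP x : is_derive x 1 P (x - m).
  rewrite /P; apply: is_derive_eq; by rewrite /GRing.scale/=; field.
have cP : continuous P.
  by move=> x; apply/differentiable_continuous/derivable1_diffP; case: (dP x).
have cf := has_deriv_on_continuous df.
have [M' M'0 HM'] := segment_bounded (abs_continuous_on_continuous acf').
have acf : abs_continuous_on l r f.
  exact: abs_continuous_on_lipschitz M'0 (has_deriv_on_lipschitz df HM').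
have acS : abs_continuous_on l r (fun x => x - m).
  apply: (@abs_continuous_on_lipschitz _ _ _ _ 1) => // x y _ xy _.
  by rewrite mul1r opprB addrA subrK ger0_norm ?subr_ge0.
have acP : abs_continuous_on l r P.
  have cS := abs_continuous_on_continuous acS.
  have [N N0 HN] := segment_bounded cS.
  apply: (@abs_continuous_on_lipschitz _ _ _ _ N) => //.
  apply: (@has_deriv_on_lipschitz _ _ _ (fun x => x - m)) => // x _.
  exact: is_derive_has_deriv_on.
pose W x := P x * f' x - (x - m) * f x.
have acW : abs_continuous_on l r W.
  by apply: abs_continuous_onB; exact: abs_continuous_onM.
have iPf : mu.-integrable `[l, r] (EFin \o (fun x => P x * f'' x)).
  by apply: integrable_continuousM => //; exact: continuous_subspaceT.
have if_ := integrable_continuous cf.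
have : \int[mu]_(x in `[l, r]) (P x * f'' x - f x) = W r - W l.
  apply: abs_continuous_on_FTC => //.
    rewrite (_ : _ \o _ = (fun x => (P x * f'' x)%:E - (f x)%:E)%E)//.
    exact: integrableB.
  have aeF : Filter (nbhs (almost_everywhere mu)) := ae_filter_ringOfSetsType mu.
  apply: filterS df' => x df' lxr.
  have xlr : x \in `[l, r] by rewrite in_itv/=; case/andP: lxr => /ltW -> /ltW ->.
  have d2 := has_deriv_on_interior lxr (df' xlr).
  have d1 := has_deriv_on_interior lxr (df _ xlr).
  have dPx := dP x.
  apply: is_derive_eq; rewrite /GRing.scale/=; ring.
rewrite RintegralB// => /eqP; rewrite subr_eq => /eqP ->.
rewrite /W /P; ring.
Qed.

Lemma Rintegral_itv_split (x : nat -> R) (n : nat) g :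
  (forall i, x i <= x i.+1) -> mu.-integrable `[x 0%N, x n] (EFin \o g) ->
  \int[mu]_(t in `[x 0%N, x n]) g t =
  \sum_(i < n) \int[mu]_(t in `[x i, x i.+1]) g t.
Proof.
move=> xS; have x0 i : x 0%N <= x i by elim: i => // i; move=> /le_trans; apply.
elim: n => [_|n IH ig]; first by rewrite big_ord0 set_itv1 Rintegral_set1.
rewrite big_ord_recr/= -IH; last first.
  by apply: integrableS ig => //; apply: subset_itvl; rewrite bnd_simp.
apply/eqP; rewrite addrC -subr_eq; apply/eqP.
rewrite Rintegral_itvB ?bnd_simp// Rintegral_itv_obnd_cbnd//.
by apply: integrableS ig => //; apply: subset_itvr; rewrite bnd_simp.
Qed.

End kernel_on_subinterval.

(** * The Peano kernel of the composite rule *)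

Section peano_kernel.
Set Implicit Arguments.
Unset Strict Implicit.
Variable R : realType.
Implicit Types (a b l r x h k : R) (f g : R -> R).
Notation mu := (@lebesgue_measure R).

(* [a + (2 i + 1) h] is the midpoint of the [i]-th subinterval, of length [2 h]. *)
Definition midpoint_dist a h (n : nat) x : R :=
  \big[Num.min/`|x - (a + h)|]_(i < n) `|x - (a + (2 * i%:R + 1) * h)|.

(** Expressing the piecewise parabola through the distance to the nearest midpoint makes it
    continuous as a composite of minima, with no gluing at the nodes. *)
Definition peano_kernel a h k (n : nat) x : R := (midpoint_dist a h n x ^+ 2 - k) / 2.

(** Distinct midpoints are at least [2 h] apart, so a point within [h] of one of them is at distance
    at least [h] from every other. *)
Lemma midpoint_distE a h (n i : nat) x : 0 < h -> (i < n)%N ->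
  `|x - (a + (2 * i%:R + 1) * h)| <= h ->
  midpoint_dist a h n x = `|x - (a + (2 * i%:R + 1) * h)|.
Proof.
move=> h0 ni xi; set m := (a + (2 * i%:R + 1) * h) in xi *.
have far (j : nat) : `|x - m| <= `|x - (a + (2 * j%:R + 1) * h)|.
  have [<-//|ij] := eqVneq i j.
  apply: le_trans (xi) _; move: xi; rewrite ler_norml => /andP[x1 x2].
  case: (ltngtP i j) ij => // ij _.
    have : i%:R + 1 <= j%:R :> R by rewrite natr1 ler_nat.
    rewrite -subr_ge0 => /(mulr_ge0 (ltW h0)); rewrite /m in x1 x2 * => ih.
    by rewrite ler_normr; apply/orP; right; lra.
  have : j%:R + 1 <= i%:R :> R by rewrite natr1 ler_nat.
  rewrite -subr_ge0 => /(mulr_ge0 (ltW h0)); rewrite /m in x1 x2 * => ih.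
  by rewrite ler_normr; apply/orP; left; lra.
apply/eqP; rewrite eq_le; apply/andP; split.
  exact: (@bigmin_le_cond _ _ _ _ (Ordinal ni)).
apply/bigmin_geP; split; last by move=> j _; exact: far.
(* The default value of the iterated minimum is the distance to midpoint number 0. *)
by have := far 0%N; rewrite mulr0 add0r mul1r.
Qed.

Lemma continuous_midpoint_dist a h (n : nat) : continuous (midpoint_dist a h n).
Proof.
have cd (m : R) : continuous (fun x : R => `|x - m|).
  move=> x; apply: (@continuous_comp _ _ _ (fun x : R => x - m) Num.norm).
    by apply: cvgB; [exact: cvg_id|exact: cvg_cst].
  exact: norm_continuous.
rewrite /midpoint_dist; elim: (index_enum _) => [|i s IH].
  by under eq_fun do rewrite big_nil; exact: cd.
under eq_fun do rewrite big_cons/=.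
by move=> x; apply: (continuous_min (cd _ x) (IH x)).
Qed.

Lemma continuous_peano_kernel a h k (n : nat) : continuous (peano_kernel a h k n).
Proof.
move=> x; rewrite /peano_kernel; apply: cvgM; last exact: cvg_cst.
apply: cvgB; last exact: cvg_cst.
by rewrite expr2; apply: cvgM; exact: continuous_midpoint_dist.
Qed.

Section quadrature.
Variables (a b : R) (n : nat).
Hypotheses (ab : a < b) (n0 : (0 < n)%N).
Let h := (b - a) / (2 * n%:R).
Let nR : 0 < n%:R :> R. Proof. by rewrite ltr0n. Qed.
Let h0 : 0 < h. Proof. by rewrite divr_gt0 ?subr_gt0 ?mulr_gt0. Qed.

Lemma quad_nodeE (i : nat) : quad_node a b n i = a + 2 * i%:R * h.
Proof. by rewrite /quad_node /h; field; rewrite gt_eqF. Qed.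

Lemma quad_node0 : quad_node a b n 0 = a.
Proof. by rewrite quad_nodeE mulr0 mul0r addr0. Qed.

Lemma quad_noden : quad_node a b n n = b.
Proof. by rewrite /quad_node mulfK ?gt_eqF// addrC subrK. Qed.

Lemma quad_node_le (i : nat) : quad_node a b n i <= quad_node a b n i.+1.
Proof. by rewrite !quad_nodeE -natr1; move: h0; lra. Qed.

Lemma quad_node_ge i : a <= quad_node a b n i.
Proof. by rewrite quad_nodeE; have := mulr_ge0 (ler0n R i) (ltW h0); lra. Qed.

Lemma quad_node_le_end i : (i <= n)%N -> quad_node a b n i <= b.
Proof.
move=> ni; rewrite -{2}quad_noden !quad_nodeE lerD2l ler_wpM2r ?(ltW h0)//.
by rewrite ler_pM2l// ler_nat.
Qed.

Lemma peano_kernelE k (i : nat) x : (i < n)%N ->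
  quad_node a b n i <= x <= quad_node a b n i.+1 ->
  peano_kernel a h k n x = ((x - (a + (2 * i%:R + 1) * h)) ^+ 2 - k) / 2.
Proof.
move=> ni; rewrite !quad_nodeE -natr1 => /andP[x1 x2].
rewrite /peano_kernel (midpoint_distE h0 ni); first by rewrite real_normK ?num_real.
by rewrite ler_norml; apply/andP; split; lra.
Qed.

(** The kernel repeats one parabola on all [n] subintervals, so each of its norms reduces to a
    computation around a single, arbitrary midpoint. *)
Lemma Rintegral_peano_kernel k (F : R -> R) (J : R) : continuous F ->
  (forall m : R, \int[mu]_(x in `[m - h, m + h]) F (((x - m) ^+ 2 - k) / 2) = J) ->
  \int[mu]_(x in `[a, b]) F (peano_kernel a h k n x) = n%:R * J.
Proof.
move=> cF FJ; rewrite -[X in `[X, _]]quad_node0 -[X in `[_, X]]quad_noden.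
rewrite Rintegral_itv_split; last 2 first.
- exact: quad_node_le.
- apply: integrable_continuous; apply: continuous_subspaceT => x.
  by apply: continuous_comp; [exact: continuous_peano_kernel|exact: cF].
rewrite (eq_bigr (fun=> J)); first by rewrite sumr_const card_ord mulr_natl.
move=> i _; rewrite -(FJ (a + (2 * i%:R + 1) * h)).
have -> : a + (2 * i%:R + 1) * h - h = quad_node a b n i by rewrite quad_nodeE; ring.
have -> : a + (2 * i%:R + 1) * h + h = quad_node a b n i.+1.
  by rewrite quad_nodeE -natr1; ring.
apply: eq_Rintegral => x; rewrite inE/= in_itv/= => xi.
by rewrite (peano_kernelE _ (ltn_ord i)).
Qed.

Lemma trapezoid_sum (u : nat -> R) : \sum_(i < n) (u i + u i.+1) =
  u 0%N + 2 * \sum_(1 <= i < n) u i + u n.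
Proof.
elim: n n0 => // -[|m] IH _; first by rewrite big_ord1 big_geq// mulr0 addr0.
rewrite big_ord_recr/= IH// [in RHS]big_nat_recr//=; ring.
Qed.

(** The kernel has the same value [(h ^+ 2 - k) / 2] at both ends of every subinterval. Hence the
    values of [f'] at interior nodes telescope away, while the slopes [h] and [- h] there collect
    the trapezoidal sum of [f]. *)
Lemma quad_error_kernel (q : \bar R) f f' f'' :
  (forall x, x \in `[a, b] -> has_deriv_on a b f x (f' x)) ->
  abs_continuous_on a b f' ->
  {ae mu, forall x, x \in `[a, b] -> has_deriv_on a b f' x (f'' x)} ->
  mu.-integrable `[a, b] (EFin \o f'') ->
  quad_error a b q n f f' =
  \int[mu]_(x in `[a, b]) (peano_kernel a h (h ^+ 2 * beta_const q ^- 2) n x * f'' x).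
Proof.
move=> df acf' df' if''; set k := h ^+ 2 * _.
pose X i := quad_node a b n i.
have XS i : X i <= X i.+1 by exact: quad_node_le.
have iK : mu.-integrable `[a, b] (EFin \o (fun x => peano_kernel a h k n x * f'' x)).
  apply: integrable_continuousM => //.
  by apply: continuous_subspaceT; exact: continuous_peano_kernel.
have if_ : mu.-integrable `[a, b] (EFin \o f).
  by apply: integrable_continuous; exact: has_deriv_on_continuous df.
have step (i : 'I_n) :
    \int[mu]_(x in `[X i, X i.+1]) (peano_kernel a h k n x * f'' x) =
    \int[mu]_(x in `[X i, X i.+1]) f x
    + ((h ^+ 2 - k) / 2 * (f' (X i.+1) - f' (X i)) - h * (f (X i) + f (X i.+1))).
  have Xi : X i < X i.+1 by rewrite /X !quad_nodeE -natr1; move: h0; lra.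
  have aX : a <= X i by exact: quad_node_ge.
  have Xb : X i.+1 <= b by apply: quad_node_le_end; exact: ltn_ord.
  have sub : `[X i, X i.+1] `<=` `[a, b] by apply: subset_itv; rewrite bnd_simp.
  pose m := a + (2 * i%:R + 1) * h.
  transitivity (\int[mu]_(x in `[X i, X i.+1]) (((x - m) ^+ 2 - k) / 2 * f'' x)).
    apply: eq_Rintegral => x; rewrite inE/= in_itv/= => xi.
    by rewrite (peano_kernelE _ (ltn_ord i)).
  rewrite (@integral_quadratic_kernel _ _ _ m k f f' f'')//.
  - have -> : X i.+1 - m = h by rewrite /X quad_nodeE -natr1 /m; ring.
    have -> : X i - m = - h by rewrite /X quad_nodeE /m; ring.
    rewrite sqrrN; ring.
  - by move=> x xi; apply: (has_deriv_onS aX Xb); apply: df; exact: sub.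
  - exact: abs_continuous_onS acf'.
  - have aeF : Filter (nbhs (almost_everywhere mu)) := ae_filter_ringOfSetsType mu.
    apply: filterS df' => x df' xi; apply: (has_deriv_onS aX Xb).
    by apply: df'; exact: sub.
  - by apply: integrableS if''.
rewrite /quad_error -[X in `[X, _]]quad_node0 -[X in `[_, X]]quad_noden.
rewrite !Rintegral_itv_split//; last 2 first.
- by rewrite quad_node0 quad_noden.
- by rewrite quad_node0 quad_noden.
rewrite [in RHS](eq_bigr _ (fun i _ => step i)) big_split/= -/X.
rewrite sumrB -mulr_sumr -mulr_sumr (trapezoid_sum (f \o X)) /=.
rewrite -(big_mkord xpredT (fun i => f' (X i.+1) - f' (X i))) telescope_sumr//.
have -> : X 0%N = a by exact: quad_node0.
have -> : X n = b by exact: quad_noden.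
set S := \sum_(i < n) _; set T := \sum_(1 <= i < n) _.
rewrite /k; move: (beta_const q ^- 2) => c.
by rewrite /h; field; rewrite gt_eqF.
Qed.

End quadrature.
End peano_kernel.

(** * Signed powers and the constants beta_q *)

Section signed_powers.
Set Implicit Arguments.
Unset Strict Implicit.
Variable R : realType.
Implicit Types (a b l x y s k : R) (f g F phi : R -> R).
Notation mu := (@lebesgue_measure R).

Lemma is_derive_continuous x f (d : R) : is_derive x 1 f d -> {for x, continuous f}.
Proof. by case=> /derivable1_diffP /differentiable_continuous. Qed.

Lemma Rintegral_FTC a b F phi : a <= b ->
  (forall x, a <= x <= b -> is_derive x 1 F (phi x)) ->
  {within `[a, b], continuous phi} ->
  \int[mu]_(x in `[a, b]) phi x = F b - F a.
Proof.
rewrite le_eqVlt => /predU1P[<- _ _|ab dF cphi].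
  by rewrite set_itv1 Rintegral_set1 subrr.
have cF : {within `[a, b], continuous F}.
  apply: continuous_subspace_itv => x xab; apply: (@is_derive_continuous _ _ (phi x)).
  by apply: dF; rewrite in_itv/= in xab.
rewrite /Rintegral (@continuous_FTC2 _ phi F a b ab cphi)//.
  have [_ Fa Fb] := (continuous_within_itvP _ ab).1 cF.
  split => // x; rewrite in_itv/= => /andP[ax xb].
  by have [|] := dF x; first by rewrite !ltW.
move=> x; rewrite in_itv/= => /andP[ax xb]; rewrite derive1E.
by have [|] := dF x; first by rewrite !ltW.
Qed.

(** The derivative is two-sided, hence obtained in the interior only; this is why the uses below
    start from a wider segment than the one of interest. *)
Lemma continuous_primitive a b phi : a < b -> {within `[a, b], continuous phi} ->
  exists F, forall x, a < x < b -> is_derive x 1 F (phi x).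
Proof.
move=> ab cphi; exists (fun x => \int[mu]_(t in `[a, x]) phi t).
move=> x /andP[ax xb]; have iphi := integrable_continuous cphi.
have [cx _ _] := (continuous_within_itvP _ ab).1 cphi.
have xab : x \in `]a, b[ by rewrite in_itv/= ax.
have [dF F'] := @continuous_FTC1_closed _ phi a x b xb iphi ax (cx _ xab).
by apply: DeriveDef; [exact: dF|rewrite -derive1E; exact: F'].
Qed.

Lemma abs_powR_lt s (e : R) : 0 < s -> 0 < e -> exists2 k : R, 0 < k & forall y,
  `|y| < k -> `|y| `^ s < e.
Proof.
move=> s0 e0; exists (e `^ s^-1); first exact: powR_gt0.
move=> y yk; have -> : e = (e `^ s^-1) `^ s by rewrite -powRrM mulVf ?gt_eqF// powRr1// ltW.
by apply: gt0_ltr_powR => //; rewrite nnegrE ?powR_ge0.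
Qed.

Lemma continuous_abs_powR s : 0 < s -> continuous (fun y => `|y| `^ s).
Proof.
move=> s0 y; have [->|y0] := eqVneq y 0.
  apply/cvgrPdist_lt => e e0; rewrite normr0 powR0 ?gt_eqF//.
  have [k k0 Hk] := abs_powR_lt s0 e0.
  apply/nbhs_ballP; exists k => // z; rewrite /ball/= sub0r normrN => /Hk.
  by rewrite sub0r normrN (ger0_norm (powR_ge0 _ _)).
apply: (@continuous_comp R R R (fun y : R => `|y|) (fun y : R => y `^ s)).
  exact: norm_continuous.
apply: is_derive_continuous; apply: is_derive1_powR; by rewrite normr_gt0.
Qed.

(* The signed power [sgn y * |y| ^ s], in a form that is visibly continuous at [0]. *)
Definition sgn_powR s y : R := (Num.max y 0) `^ s - (Num.max (- y) 0) `^ s.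

Lemma sgn_powR_ge0 s y : 0 < s -> 0 <= y -> sgn_powR s y = y `^ s.
Proof.
move=> s0 y0; rewrite /sgn_powR (max_idPl y0) (max_idPr _) ?oppr_le0//.
by rewrite powR0 ?gt_eqF// subr0.
Qed.

Lemma sgn_powRN s y : sgn_powR s (- y) = - sgn_powR s y.
Proof. by rewrite /sgn_powR opprK opprB. Qed.

Lemma sgn_powR_le0 s y : 0 < s -> y <= 0 -> sgn_powR s y = - (- y) `^ s.
Proof. by move=> s0 y0; rewrite -{1}[y]opprK sgn_powRN sgn_powR_ge0// oppr_ge0. Qed.

Lemma continuous_sgn_powR s : 0 < s -> continuous (sgn_powR s).
Proof.
move=> s0 y.
have cmax : continuous (fun y : R => `|Num.max y 0| `^ s).
  move=> z; apply: (@continuous_comp _ _ _ (fun z : R => Num.max z 0) (fun z => `|z| `^ s)).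
    by apply: (@continuous_max _ _ (fun z : R => z) (fun=> 0)); [exact: cvg_id|exact: cvg_cst].
  exact: continuous_abs_powR.
have E : sgn_powR s = (fun y => `|Num.max y 0| `^ s - `|Num.max (- y) 0| `^ s).
  by apply/funext => z; rewrite /sgn_powR !ger0_norm// le_max lexx orbT.
have cmaxN : {for y, continuous (fun z : R => `|Num.max (- z) 0| `^ s)}.
  apply: (@continuous_comp R R R (fun z => - z) (fun z => `|Num.max z 0| `^ s)).
    exact: opp_continuous.
  exact: cmax.
by rewrite E; exact: cvgB (cmax y) cmaxN.
Qed.

Lemma mul_sgn_powR s y : 0 < s -> y * sgn_powR s y = `|y| `^ (s + 1).
Proof.
move=> s0; have key (z : R) : 0 <= z -> z * z `^ s = z `^ (s + 1).
  by move=> z0; rewrite -[in LHS](addrK 1 s) mulr_powRB1// addr_gt0.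
case: (leP 0 y) => y0; first by rewrite sgn_powR_ge0// key// ger0_norm.
have y0' := ltW y0.
by rewrite sgn_powR_le0// ler0_norm// mulrN -mulNr key// oppr_ge0.
Qed.

Lemma abs_sgn_powR s y : 0 < s -> `|sgn_powR s y| = `|y| `^ s.
Proof.
move=> s0; case: (leP 0 y) => y0.
  by rewrite sgn_powR_ge0// (ger0_norm (powR_ge0 _ _)) ger0_norm.
by rewrite sgn_powR_le0 ?(ltW y0)// normrN (ger0_norm (powR_ge0 _ _)) ler0_norm ?(ltW y0).
Qed.

Lemma sgn_powRZ s k y : 0 < s -> 0 <= k -> sgn_powR s (k * y) = k `^ s * sgn_powR s y.
Proof.
move=> s0 k0; case: (leP 0 y) => y0.
  by rewrite !sgn_powR_ge0 ?mulr_ge0// powRM.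
have y0' := ltW y0.
rewrite !sgn_powR_le0// ?mulr_ge0_le0// -mulrN powRM ?oppr_ge0//; ring.
Qed.

(** Away from 0 this is the power rule and a reflection. At 0 the difference quotient is bounded by
    [|y| ^ s], which tends to 0 because [s] is positive. *)
Lemma is_derive_abs_powR s y : 0 < s ->
  is_derive y 1 (fun y => `|y| `^ (s + 1)) ((s + 1) * sgn_powR s y).
Proof.
move=> s0; have pos (z : R) : 0 < z ->
    is_derive z 1 (fun y => `|y| `^ (s + 1)) ((s + 1) * sgn_powR s z).
  move=> z0; have := @is_derive1_powR R (s + 1) z z0.
  rewrite addrK -(sgn_powR_ge0 s0 (ltW z0)) => /is_deriveP H.
  apply/is_deriveP => e /H[k k0 Hk]; exists (Num.min k z); first by rewrite lt_min k0.
  move=> w; rewrite lt_min => /andP[wk wz].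
  have w0 : 0 < w by move: wz; rewrite ltr_norml => /andP[]; lra.
  by rewrite (gtr0_norm w0) (gtr0_norm z0); exact: Hk.
case: (ltgtP 0 y) => [y0|y0|<-]; first exact: pos.
  have y0' : 0 < - y by rewrite oppr_gt0.
  have /is_deriveP H := pos _ y0'.
  apply/is_deriveP => e /H[k k0 Hk]; exists k => // w wk.
  have := Hk (- w); rewrite !normrN (_ : - w - - y = - (w - y)); last by ring.
  by rewrite normrN sgn_powRN !mulrN mulNr opprK; apply.
apply/is_deriveP => e e0; have [k k0 Hk] := abs_powR_lt s0 e0.
exists k => // w; rewrite subr0 => wk.
rewrite normr0 powR0 ?gt_eqF ?addr_gt0// /sgn_powR oppr0 subrr mulr0 mul0r ?subr0 ?addr0.
rewrite (ger0_norm (powR_ge0 _ _)) -mul_sgn_powR//.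
apply: le_trans (ler_norm _) _; rewrite normrM abs_sgn_powR// mulrC.
by apply: ler_wpM2r => //; exact/ltW/Hk.
Qed.

End signed_powers.

(** * The beta integral with second argument 1/2 *)

Section beta_integral.
Set Implicit Arguments.
Unset Strict Implicit.
Variable R : realType.
Implicit Types (a b l x y s k m h : R) (f g F phi : R -> R).
Notation mu := (@lebesgue_measure R).

Lemma eq_Rintegral_itv a b f g : (forall x, a <= x <= b -> f x = g x) ->
  \int[mu]_(x in `[a, b]) f x = \int[mu]_(x in `[a, b]) g x.
Proof. by move=> fg; apply: eq_Rintegral => x; rewrite inE/= in_itv/= => /fg. Qed.

Lemma is_derive_MVT a b F phi : a < b ->
  (forall x, a <= x <= b -> is_derive x 1 F (phi x)) ->
  exists2 c, a < c < b & F b - F a = phi c * (b - a).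
Proof.
move=> ab dF; have [||c] := @MVT R F phi a b ab.
- move=> x; rewrite in_itv/= => /andP[ax xb].
  by apply: dF; rewrite (ltW ax) (ltW xb).
- apply: continuous_subspace_itv => x xab; apply: (@is_derive_continuous _ _ _ (phi x)).
  by apply: dF; rewrite in_itv/= in xab.
by rewrite in_itv/= => cab E; exists c.
Qed.

Lemma is_derive_compl F phi (d c x : R) : is_derive (d * x + c) 1 F (phi (d * x + c)) ->
  is_derive x 1 (fun x => F (d * x + c)) (d * phi (d * x + c)).
Proof.
move=> dF; rewrite mulrC; apply: (@is_derive1_comp R F (fun x => d * x + c)).
apply: is_derive_eq; rewrite /GRing.scale/=; ring.
Qed.

Section half_beta.
Variable r : R.
Hypothesis r1 : 1 < r.
Let s := r - 1.
Let s0 : 0 < s. Proof. by rewrite subr_gt0. Qed.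

(* Substituting [t = 1 - u ^ 2] on [[0, 1 - d]] and letting [d] tend to [0]. *)
Lemma half_euler_beta :
  2^-1 * euler_beta r 2^-1 = \int[mu]_(u in `[0, 1]) (1 - u ^+ 2) `^ s.
Proof.
pose phi (u : R) := `|1 - u ^+ 2| `^ s.
have cphi : continuous phi.
  move=> u; apply: (@continuous_comp R R R (fun u => 1 - u ^+ 2) (fun y => `|y| `^ s)).
    apply: cvgB; first exact: cvg_cst.
    exact: exprn_continuous.
  exact: continuous_abs_powR.
have [S dS] := @continuous_primitive R (-1) 2 phi ltac:(lra) (continuous_subspaceT cphi).
have -> : \int[mu]_(u in `[0, 1]) (1 - u ^+ 2) `^ s = S 1 - S 0.
  have <- : \int[mu]_(u in `[0, 1]) phi u = S 1 - S 0.
    apply: Rintegral_FTC => //; last exact: continuous_subspaceT.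
    by move=> x /andP[x0 x1]; apply: dS; apply/andP; split; lra.
  apply: eq_Rintegral_itv => u /andP[u0 u1].
  by rewrite /phi ger0_norm// subr_ge0 expr_le1.
pose d (i : nat) : R := i.+1%:R^-1.
have d0 i : 0 < d i by rewrite invr_gt0.
have d1 i : d i <= 1 by rewrite invf_le1// ler1n.
pose Fi (i : nat) : set R := `[0, 1 - d i]%classic.
pose g (t : R) : R := t `^ s * (1 - t) `^ (2^-1 - 1).
have g0 t : 0 <= g t by rewrite mulr_ge0 ?powR_ge0.
have mg : measurable_fun setT g.
  apply: measurable_funM; first exact: measurable_powR.
  by apply: (measurableT_comp (measurable_powR _)) => //; apply: measurable_funB.
have intF i : (\int[mu]_(t in Fi i) (g t)%:E = (2 * (S 1 - S ((d i) `^ 2^-1)))%:E)%E.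
  pose A (t : R) := - 2 * S ((1 - t) `^ 2^-1).
  (* The absolute value makes [g'] continuous at 0 from both sides, and is also what the chain rule
     produces from [phi]; on nonnegative [t] it agrees with [g]. *)
  pose g' (t : R) : R := `|t| `^ s * (1 - t) `^ (2^-1 - 1).
  have dA t : 0 <= t <= 1 - d i -> is_derive t 1 A (g' t).
    move=> /andP[t0 td]; have t1 : 0 < 1 - t by have := d0 i; lra.
    have sq : ((1 - t) `^ 2^-1) ^+ 2 = 1 - t.
      by rewrite powR12_sqrt ?sqr_sqrtr// ltW.
    have dpow : is_derive t 1 (fun t => (1 - t) `^ 2^-1)
        (- (2^-1 * (1 - t) `^ (2^-1 - 1))).
      have -> : (fun t : R => (1 - t) `^ 2^-1) = (fun x => (-1 * x + 1) `^ 2^-1).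
        by apply/funext => x; congr (_ `^ _); ring.
      have tE : 1 - t = -1 * t + 1 by ring.
      rewrite tE in t1 *.
      have -> : - (2^-1 * (-1 * t + 1) `^ (2^-1 - 1)) =
        -1 * (2^-1 * (-1 * t + 1) `^ (2^-1 - 1)) by ring.
      apply: (@is_derive_compl (fun x => x `^ 2^-1) (fun x => 2^-1 * x `^ (2^-1 - 1))).
      exact: is_derive1_powR.
    have dSt : is_derive ((1 - t) `^ 2^-1) 1 S (phi ((1 - t) `^ 2^-1)).
      apply: dS; apply/andP; split; first by have := powR_ge0 (1 - t) 2^-1; lra.
      apply: le_lt_trans (_ : 1 < 2); last by lra.
      have := @ge0_ler_powR R 2^-1 ltac:(lra) (1 - t) 1.
      by rewrite powR1 !nnegrE; apply; lra.
    have dcomp := @is_derive1_comp R S (fun t => (1 - t) `^ 2^-1) t _ _ dSt dpow.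
    have -> : g' t = - 2 * (phi ((1 - t) `^ 2^-1) * - (2^-1 * (1 - t) `^ (2^-1 - 1))).
      rewrite /phi sq; have -> : 1 - (1 - t) = t by ring.
      by rewrite /g'; field.
    by apply: is_deriveZ; exact: dcomp.
  have cg' : {within `[0, 1 - d i], continuous g'}.
    apply: continuous_subspace_itv => t; rewrite in_itv/= => /andP[t0 td].
    have t1 : 0 < 1 - t by have := d0 i; lra.
    apply: cvgM; first exact: continuous_abs_powR.
    apply: (@continuous_comp R R R (fun t => 1 - t) (fun y => y `^ (2^-1 - 1))).
      by apply: cvgB; [exact: cvg_cst|exact: cvg_id].
    by apply: is_derive_continuous; exact: is_derive1_powR.
  have d1i : 0 <= 1 - d i by rewrite subr_ge0.
  have := Rintegral_FTC d1i dA cg'; rewrite /A subr0 powR1.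
  have -> : 1 - (1 - d i) = d i by ring.
  have -> : -2 * S (d i `^ 2^-1) - -2 * S 1 = 2 * (S 1 - S (d i `^ 2^-1)) by ring.
  move=> <-.
  rewrite /Rintegral fineK.
    apply: eq_integral => t; rewrite inE /Fi/= in_itv/= => /andP[t0 _].
    by rewrite /g /g' ger0_norm.
  apply: integrable_fin_num => //; exact: integrable_continuous.
have bigF : \bigcup_i Fi i = `[0, 1[%classic.
  apply/seteqP; split=> [t [i _]|t].
    rewrite /Fi/= !in_itv/= => /andP[-> td]/=; have := d0 i; lra.
  rewrite /= in_itv/= => /andP[t0 t1].
  have t1' : 0 < 1 - t by lra.
  have [i Hi] := ltr_add_invr t1'.
  have {}Hi : d i < 1 - t by rewrite add0r in Hi.
  by exists i => //; rewrite /Fi/= in_itv/= t0/=; lra.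
have nd : nondecreasing_seq Fi.
  move=> i j ij; rewrite subsetEset; apply: subset_itvl; rewrite bnd_simp.
  by rewrite lerD2l lerN2 lef_pV2 ?posrE// ler_nat ltnS.
have cv : (\int[mu]_(t in Fi i) (g t)%:E @[i --> \oo] --> \int[mu]_(t in `[0%R, 1%R[) (g t)%:E)%E.
  rewrite -bigF; apply: ge0_nondecreasing_set_cvg_integral => //.
  - by move=> i; exact: measurable_itv.
  - move=> i; apply/measurable_EFinP; exact: measurable_funTS.
  - by move=> i x _; rewrite lee_fin.
have cv2 : (\int[mu]_(t in Fi i) (g t)%:E @[i --> \oo] --> (2 * (S 1 - S 0))%:E)%E.
  under eq_fun do rewrite intF.
  apply: cvg_EFin; first by apply: nearW.
  apply: cvgMr; apply: cvgB; first exact: cvg_cst.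
  have cS : {for 0, continuous S}.
    by apply: (@is_derive_continuous _ _ _ (phi 0)); apply: dS; apply/andP; split; lra.
  apply: (@cvg_comp _ _ _ (fun i => d i `^ 2^-1) S _ (nbhs (0 : R))); last exact: cS.
  have -> : (fun i => d i `^ 2^-1) = (fun i => `|d i| `^ 2^-1).
    by apply/funext => i; rewrite gtr0_norm.
  have c2 := @continuous_abs_powR R 2^-1 ltac:(lra) 0.
  rewrite /continuous_at normr0 powR0 ?gt_eqF ?invr_gt0// in c2.
  apply: cvg_comp c2; exact: cvg_harmonic.
have E : (\int[mu]_(t in `[0%R, 1%R[) (g t)%:E = (2 * (S 1 - S 0))%:E)%E.
  exact: cvg_unique cv cv2.
have -> : euler_beta r 2^-1 = 2 * (S 1 - S 0).
  rewrite /euler_beta /Rintegral -integral_itv_bndo_bndc ?E//.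
  by apply/measurable_EFinP; exact: measurable_funTS.
by rewrite mulrA mulVf// mul1r.
Qed.

End half_beta.
End beta_integral.

(** * The constant beta_q for 1 < q < oo *)

Section beta_constant.
Set Implicit Arguments.
Unset Strict Implicit.
Variable R : realType.
Implicit Types (a b l x y k m h : R) (f g F phi : R -> R).
Notation mu := (@lebesgue_measure R).

Variable r : R.
Hypothesis r1 : 1 < r.
Let s := r - 1.
Let s0 : 0 < s. Proof. by rewrite subr_gt0. Qed.
(** A single continuous integrand for both sides of the equation of beta_q: it is [- (1 - x^2)^s] on
    [0, 1] and [(x^2 - 1)^s] from 1 on. The equation says that a primitive of [phi] returns at
    beta_q to its value at 0. *)
Let phi x := sgn_powR s (x ^+ 2 - 1).

Lemma continuous_sgn_powR_sqr : continuous phi.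
Proof.
move=> x; apply: (@continuous_comp R R R (fun x => x ^+ 2 - 1) (sgn_powR s)).
  by apply: cvgB; [exact: exprn_continuous|exact: cvg_cst].
exact: continuous_sgn_powR.
Qed.

Lemma primitive_sgn_powR_01 F : (forall x, 0 <= x <= 1 -> is_derive x 1 F (phi x)) ->
  F 0 - F 1 = 2^-1 * euler_beta r 2^-1.
Proof.
move=> dF; rewrite half_euler_beta//.
have <- : \int[mu]_(x in `[0, 1]) (- phi x) = F 0 - F 1.
  have -> : F 0 - F 1 = (- F 1) - (- F 0) by ring.
  apply: (@Rintegral_FTC _ _ _ (fun x => - F x)) => //.
    by move=> x /dF dFx; exact: is_deriveN.
  apply: continuous_subspaceT => x; apply: cvgN; exact: continuous_sgn_powR_sqr.
apply: eq_Rintegral_itv => x /andP[x0 x1].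
by rewrite /phi sgn_powR_le0 ?opprK ?opprB// subr_le0 expr_le1.
Qed.

Lemma primitive_sgn_powR_ge1 F b : 1 <= b ->
  (forall x, 1 <= x <= b -> is_derive x 1 F (phi x)) ->
  F b - F 1 = \int[mu]_(x in `[1, b]) ((x ^+ 2 - 1) `^ s).
Proof.
move=> b1 dF; rewrite -(Rintegral_FTC b1 dF); last first.
  by apply: continuous_subspaceT; exact: continuous_sgn_powR_sqr.
apply: eq_Rintegral_itv => x /andP[x1 _].
by rewrite /phi sgn_powR_ge0// subr_ge0 expr_ge1// (le_trans ler01).
Qed.

(** [xget] returns a solution once one exists. The primitive [F] drops by [B] on [0, 1] and has
    regained at least [B] by [B + 2], so the intermediate value theorem applies on [[1, B + 2]]. *)
Lemma beta_const_spec : 1 < beta_const r%:E /\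
  \int[mu]_(x in `[1, beta_const r%:E]) ((x ^+ 2 - 1) `^ s) = 2^-1 * euler_beta r 2^-1.
Proof.
rewrite /beta_const gt_eqF//; set E := [set beta | _].
suff [b Eb] : exists b, E b by have := xgetPex 0 (ex_intro _ b Eb).
set B := 2^-1 * euler_beta r 2^-1.
have B0 : 0 <= B.
  rewrite mulr_ge0// Rintegral_ge0// => x _; by rewrite mulr_ge0 ?powR_ge0.
have [F dF] := @continuous_primitive R (-1) (B + 3) phi ltac:(lra)
  (continuous_subspaceT continuous_sgn_powR_sqr).
have F01 : F 0 - F 1 = B.
  by apply: primitive_sgn_powR_01 => x /andP[x0 x1]; apply: dF; apply/andP; split; lra.
(* Strict positivity is what later separates the solution from 1. *)
have B1 : 0 < B.
  have [|x|c /andP[c0 c1]] := @is_derive_MVT R 0 1 F phi; first exact: ltr01.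
    by move=> /andP[x0 x1]; apply: dF; apply/andP; split; lra.
  have c21 : c ^+ 2 - 1 < 0 by rewrite subr_lt0 expr_lt1// ltW.
  rewrite subr0 mulr1 /phi sgn_powR_le0 ?(ltW c21)//.
  by have := @powR_gt0 R (- (c ^+ 2 - 1)) s; rewrite oppr_gt0 => /(_ c21); lra.
have F12 : F 1 <= F 2.
  have [|x|c /andP[c0 c1]] := @is_derive_MVT R 1 2 F phi; first by lra.
    by move=> /andP[x0 x1]; apply: dF; apply/andP; split; lra.
  have c21 : 0 <= c ^+ 2 - 1 by rewrite subr_ge0 expr_ge1// ?ltW//; lra.
  by rewrite /phi sgn_powR_ge0//; have := powR_ge0 (c ^+ 2 - 1) s; lra.
(* From 2 on the integrand is at least 1, so a length [B] past 2 makes up for the drop. *)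
have F2X : B <= F (B + 2) - F 2.
  have [|x|c /andP[c0 c1] ->] := @is_derive_MVT R 2 (B + 2) F phi; first by lra.
    by move=> /andP[x0 x1]; apply: dF; apply/andP; split; lra.
  rewrite addrK ler_peMl// /phi.
  have c21 : 1 <= c ^+ 2 - 1.
    by have : 2 * 2 <= c * c; [apply: ler_pM => //; lra|rewrite expr2; lra].
  rewrite sgn_powR_ge0//; last by lra.
  by have := @ler_powR R _ c21 0 s (ltW s0); rewrite powRr0.
have cF : {within `[1, B + 2], continuous F}.
  apply: continuous_subspace_itv => x; rewrite in_itv/= => /andP[x0 x1].
  by apply: (@is_derive_continuous _ _ _ (phi x)); apply: dF; apply/andP; split; lra.
have [||b] := @IVT R F 1 (B + 2) (F 0) _ cF; first by lra.
  by rewrite ge_min le_max; apply/andP; split; apply/orP; [left|right]; lra.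
rewrite in_itv/= => /andP[b1 bX] Fb.
exists b; split.
  by rewrite lt_neqAle b1 andbT; apply/eqP => b1'; move: F01; rewrite -Fb -b1'; lra.
have <- : F b - F 1 = \int[mu]_(x in `[1, b]) (x ^+ 2 - 1) `^ s; last by rewrite Fb.
apply: primitive_sgn_powR_ge1 => // x /andP[x0 x1]; apply: dF; apply/andP; split; lra.
Qed.

Let be := beta_const r%:E.
Let be1 : 1 < be. Proof. by case: beta_const_spec. Qed.

(** This is the vanishing of the integral of [phi] over [[- be, be]]: the equation of beta_q gives
    it on the right half, and [phi] is even. *)
Lemma beta_const_primitive : exists2 F,
  (forall x, - be <= x <= be -> is_derive x 1 F (phi x)) & F be = F (- be).
Proof.
have be11 : - (be + 1) < be + 1 by move: be1; lra.
have [F dF] := @continuous_primitive R _ _ phi be11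
  (continuous_subspaceT continuous_sgn_powR_sqr).
have dF' x : - be <= x <= be -> is_derive x 1 F (phi x).
  by move=> /andP[x0 x1]; apply: dF; apply/andP; split; lra.
exists F => //.
have FE : F be - F 1 = F 0 - F 1.
  transitivity (2^-1 * euler_beta r 2^-1); last first.
    apply/esym/primitive_sgn_powR_01 => x /andP[x0 x1].
    by apply: dF'; apply/andP; split; move: be1; lra.
  have [_ <-] := beta_const_spec; apply: primitive_sgn_powR_ge1; first exact: ltW.
  by rewrite -/be => x /andP[x0 x1]; apply: dF'; apply/andP; split; move: be1; lra.
(* As [phi] is even, [F x + F (- x)] has zero derivative and equals [2 F 0], while [FE] says that
   [F be = F 0]. *)
have [|x|c _] := @is_derive_MVT R 0 be (fun x => F x + F (- x)) (fun=> 0).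
- by move: be1; lra.
- move=> /andP[x0 x1].
  have d1 : is_derive x 1 F (phi x) by apply: dF'; apply/andP; split; move: be1; lra.
  have d2 : is_derive x 1 (fun x => F (- x)) (- phi (- x)).
    have -> : (fun x => F (- x)) = (fun x => F (-1 * x + 0)).
      by apply/funext => z; rewrite addr0 mulN1r.
    have -> : - phi (- x) = -1 * phi (-1 * x + 0) by rewrite addr0 !mulN1r.
    apply: is_derive_compl; rewrite addr0 mulN1r; apply: dF'; apply/andP; split; move: be1; lra.
  have -> : 0 = phi x - phi (- x) by rewrite /phi sqrrN subrr.
  exact: is_deriveD.
rewrite mul0r oppr0; move: FE; lra.
Qed.

(* With [P := ((x - m) ^ 2 - k) / 2], one has
   [((x - m) |P| ^ r)' = (2 r + 1) |P| ^ r + r k sgn(P) |P| ^ (r - 1)],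
   and the equation defining [beta_r] says that the last term has integral [0]. *)
Lemma integral_abs_kernel_powR h m : 0 < h ->
  let k := h ^+ 2 * be ^- 2 in
  \int[mu]_(x in `[m - h, m + h]) `|((x - m) ^+ 2 - k) / 2| `^ r =
  2 * h / (2 * r + 1) * ((h ^+ 2 - k) / 2) `^ r.
Proof.
move=> h0 k.
have [T dT TE] := beta_const_primitive.
have be0 : 0 < be by move: be1; lra.
have ke : k = (h / be) ^+ 2 by rewrite /k expr_div_n.
have k0 : 0 < k by rewrite ke exprn_gt0// divr_gt0.
have r21 : 0 < 2 * r + 1 by move: r1; lra.
pose P x := ((x - m) ^+ 2 - k) / 2.
have dP x : is_derive x 1 P (x - m).
  by rewrite /P; apply: is_derive_eq; rewrite /GRing.scale/=; field.
pose V x := (x - m) * `|P x| `^ r.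
have rs : r = s + 1 by rewrite /s subrK.
have dV x : is_derive x 1 V ((2 * r + 1) * `|P x| `^ r + r * k * sgn_powR s (P x)).
  have dabs : is_derive x 1 (fun x => `|P x| `^ r) (r * sgn_powR s (P x) * (x - m)).
    rewrite rs; apply: (@is_derive1_comp R (fun y => `|y| `^ (s + 1)) P).
    exact: is_derive_abs_powR.
  rewrite /V; apply: is_derive_eq; rewrite /GRing.scale/=.
  rewrite [in RHS]rs -mul_sgn_powR// -rs.
  have -> : (x - m) * (r * sgn_powR s (P x) * (x - m)) =
     r * sgn_powR s (P x) * (2 * P x + k) by rewrite /P; field.
  rewrite [X in _ + X = _](_ : _ = P x * sgn_powR s (P x)); first by ring.
  by rewrite mul_sgn_powR// -rs subr0 mulr1.
(* With [y = be (x - m) / h] one has [P x = (k / 2) (y^2 - 1)]. The factor [(k / 2)^s] comes from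
   homogeneity of the signed power, and [h / be] undoes the chain rule. *)
pose C := (k / 2) `^ s * (h / be).
pose Z x := C * T (be / h * x + - (be / h) * m).
have dZ x : m - h <= x <= m + h -> is_derive x 1 Z (sgn_powR s (P x)).
  move=> /andP[x1 x2].
  have -> : sgn_powR s (P x) = C * (be / h * phi (be / h * x + - (be / h) * m)).
    rewrite /C mulrA -[_ * (h / be) * _]mulrA (_ : h / be * (be / h) = 1); last first.
      by field; rewrite !gt_eqF.
    have k20 : 0 <= k / 2 by move: k0; lra.
    rewrite mulr1 /phi -(sgn_powRZ _ s0 k20); congr (sgn_powR _ _).
    by rewrite /P ke; field; rewrite !gt_eqF.
  apply: is_deriveZ; apply: is_derive_compl; apply: dT.
  rewrite -[_ * x + _](_ : be * ((x - m) / h) = _); last by field; rewrite gt_eqF.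
  have : `|(x - m) / h| <= 1.
    rewrite normf_div (gtr0_norm h0) ler_pdivrMr// mul1r ler_norml.
    by apply/andP; split; lra.
  rewrite ler_norml => /andP[y1 y2]; apply/andP; split.
    by rewrite -[- be]mulr1 mulNr -mulrN ler_pM2l.
  by rewrite -[leRHS]mulr1 ler_pM2l.
pose G x := (2 * r + 1)^-1 * (V x - r * k * Z x).
have dG x : m - h <= x <= m + h -> is_derive x 1 G (`|P x| `^ r).
  move=> /dZ dZx; have dVx := dV x.
  rewrite /G; apply: is_derive_eq; rewrite /GRing.scale/=.
  by field; rewrite gt_eqF.
rewrite (@Rintegral_FTC _ _ _ G (fun x => `|P x| `^ r))//; last 2 first.
- by lra.
- apply: continuous_subspaceT => x.
  apply: (@continuous_comp R R R P (fun y => `|y| `^ r)).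
    exact: is_derive_continuous (dP x).
  by apply: continuous_abs_powR; move: r1; lra.
have hk : `|P (m + h)| = (h ^+ 2 - k) / 2 /\ `|P (m - h)| = (h ^+ 2 - k) / 2.
  have -> : P (m + h) = (h ^+ 2 - k) / 2 by rewrite /P; congr ((_ ^+ 2 - _) / _); ring.
  have -> : P (m - h) = (h ^+ 2 - k) / 2 by rewrite /P; field.
  rewrite ger0_norm// divr_ge0// subr_ge0 /k ler_piMr ?sqr_ge0//.
  by rewrite invf_le1 ?exprn_gt0// expr_ge1 ?ltW.
have [E1 E2] := hk; rewrite /G /V E1 E2 /Z.
(* The ends of the interval are sent to [be] and [- be], where [T] agrees; so [Z] cancels and only
   the boundary terms of [V] remain. *)
have -> : be / h * (m + h) + - (be / h) * m = be by field; rewrite gt_eqF.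
have -> : be / h * (m - h) + - (be / h) * m = - be by field; rewrite gt_eqF.
by rewrite TE; field; rewrite gt_eqF.
Qed.

End beta_constant.

(** * Hoelder bounds on a segment *)

Section hoelder_on.
Set Implicit Arguments.
Unset Strict Implicit.
Variable R : realType.
Variables (a b : R).
Implicit Types (f g K phi : R -> R) (M r : R).
Notation mu := (@lebesgue_measure R).
Local Notation I := (`[a, b]%classic : set (measurableTypeR R)).

Lemma within_continuous_comp f g : {within I, continuous f} -> continuous g ->
  {within I, continuous (fun x => g (f x))}.
Proof. by move=> cf cg x; apply: continuous_comp; [exact: cf|exact: cg]. Qed.

Lemma measurable_abs_restrict phi : measurable_fun I phi ->
  measurable_fun I (fun x => `|phi x|%:E).
Proof. by move=> mphi; apply/measurable_EFinP; exact: measurableT_comp. Qed.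

Lemma norm_on_1 phi : norm_on a b 1%E phi = (\int[mu]_(x in I) `|phi x|%:E)%E.
Proof.
rewrite /norm_on Lnorm1 [RHS]integral_mkcond; apply: eq_integral => x _.
by rewrite /= !patchE; case: ifPn => // _; rewrite normr0.
Qed.

Lemma norm_on_EFin r phi : 0 < r -> norm_on a b r%:E phi =
  ((\int[mu]_(x in I) (`|phi x| `^ r)%:E) `^ r^-1)%E.
Proof.
move=> r0; rewrite /norm_on unlock; congr (_ `^ _)%E.
rewrite [RHS]integral_mkcond; apply: eq_integral => x _.
by rewrite /= !patchE; case: ifPn => // _; rewrite normr0 powR0// gt_eqF.
Qed.

Lemma norm_on_continuous r phi : 0 < r -> {within I, continuous phi} ->
  norm_on a b r%:E phi = ((\int[mu]_(x in I) `|phi x| `^ r) `^ r^-1)%:E.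
Proof.
move=> r0 cphi; rewrite norm_on_EFin// -poweR_EFin; congr (_ `^ _)%E.
rewrite /Rintegral fineK//; apply: integrable_fin_num => //.
apply: (@integrable_continuous _ _ _ (fun x => `|phi x| `^ r)).
by apply: (@within_continuous_comp phi (fun y => `|y| `^ r)) => //; exact: continuous_abs_powR.
Qed.

(** The norm of exponent +oo is defined by cases on the positivity of the total measure; this
    selects the essential supremum. *)
Lemma lebesgue_measureT_gt0 : (0 < mu setT)%E.
Proof.
apply: (@lt_le_trans _ _ (mu `[0, 1]%classic)); last by apply: le_measure; rewrite ?inE.
by rewrite lebesgue_measure_itv/= lte_fin ltr01 sube0 lte_fin.
Qed.

Lemma hoelder_on_1 K phi M : 0 <= M -> (forall x, x \in `[a, b] -> `|K x| <= M) ->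
  measurable_fun I K -> measurable_fun I phi ->
  (\int[mu]_(x in I) `|K x * phi x|%:E <= M%:E * norm_on a b 1%E phi)%E.
Proof.
move=> M0 KM mK mphi; rewrite norm_on_1 -ge0_integralZl//; last first.
  exact: measurable_abs_restrict.
apply: ge0_le_integral => //.
- by apply: measurable_abs_restrict; exact: measurable_funM.
- apply: emeasurable_funM => //; exact: measurable_abs_restrict.
- by move=> x xI; rewrite -EFinM lee_fin normrM ler_wpM2r// KM.
Qed.

Lemma hoelder_on_y K phi : {within I, continuous K} -> measurable_fun I phi ->
  (\int[mu]_(x in I) `|K x * phi x|%:E <=
    (\int[mu]_(x in I) `|K x|)%:E * norm_on a b +oo%E phi)%E.
Proof.
move=> cK mphi; have mK := measurable_int mu (integrable_continuous cK).
move/measurable_EFinP in mK.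
have iK := integrable_norm (integrable_continuous cK).
have N0 : (0 <= norm_on a b +oo%E phi)%E by exact: Lnorm_ge0.
rewrite {1}/Rintegral fineK; last exact: integrable_fin_num.
rewrite muleC -ge0_integralZl//; last exact: measurable_abs_restrict.
apply: ae_ge0_le_integral => //.
- by apply: measurable_abs_restrict; exact: measurable_funM.
- by move=> x _; rewrite mule_ge0.
- by apply: emeasurable_funM => //; exact: measurable_abs_restrict.
have := @ess_sup_ge _ _ _ mu (abse \o (EFin \o (phi \_ I))).
have aeF : Filter (nbhs (almost_everywhere mu)) := ae_filter_ringOfSetsType mu.
apply: filterS => x /=; rewrite /norm_on unlock lebesgue_measureT_gt0 => H xI.
rewrite normrM mulrC EFinM; apply: lee_wpmul2r => //.
by apply: le_trans H; rewrite patchE mem_set.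
Qed.

Lemma hoelder_on_EFin K phi p q : 0 < p -> 0 < q -> p^-1 + q^-1 = 1 ->
  {within I, continuous K} -> measurable_fun I phi ->
  (\int[mu]_(x in I) `|K x * phi x|%:E <=
    ((\int[mu]_(x in I) `|K x| `^ q) `^ q^-1)%:E * norm_on a b p%:E phi)%E.
Proof.
move=> p0 q0 pq cK mphi; have mK := measurable_int mu (integrable_continuous cK).
move/measurable_EFinP in mK.
rewrite -norm_on_continuous//.
have := @hoelder _ _ _ mu (K \_ I) (phi \_ I) q p.
move=> /(_ ((measurable_restrictT _ (measurable_itv `[a, b])).1 mK)).
move=> /(_ ((measurable_restrictT _ (measurable_itv `[a, b])).1 mphi)).
rewrite addrC pq => /(_ q0 p0 erefl); apply: le_trans.
rewrite Lnorm1 [X in (X <= _)%E]integral_mkcond le_eqVlt; apply/orP; left; apply/eqP.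
apply: eq_integral => x _; rewrite /= !patchE; case: ifPn => // _.
by rewrite mul0r normr0.
Qed.

(** On a segment L^p is contained in L^1, by Hoelder's inequality against the constant 1. *)
Lemma admissible_integrable p f f' f'' : (1 <= p)%E -> admissible a b p f f' f'' ->
  mu.-integrable I (EFin \o f'').
Proof.
move=> p1 [_ _ _]; rewrite inE/= => /andP[]; rewrite !inE/= => mf fin.
have mf'' : measurable_fun I f''.
  by apply/(measurable_restrictT _ (measurable_itv `[a, b])).
apply/integrableP; split; first exact/measurable_EFinP.
have -> : (\int[mu]_(x in I) `|(EFin \o f'') x| = \int[mu]_(x in I) `|1 * f'' x|%:E)%E.
  by apply: eq_integral => x _; rewrite mul1r.
have c1 : {within I, continuous (cst 1 : R -> R)} by move=> x; exact: cvg_cst.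
have fin_bound (M : R) : 0 <= M -> (\int[mu]_(x in I) `|cst 1 x * f'' x|%:E <=
     M%:E * norm_on a b p f'')%E -> (\int[mu]_(x in I) `|1 * f'' x|%:E < +oo)%E.
  by move=> M0 /le_lt_trans; apply; apply: lte_mul_pinfty.
case: p p1 {fin} fin_bound => [r| |]//.
  rewrite lee_fin le_eqVlt => /predU1P[<-|r1] fin_bound.
    by apply: (fin_bound 1) => //; apply: hoelder_on_1 => // x _; rewrite normr1.
  have r0 : 0 < r by rewrite (lt_trans ltr01).
  have r1' : 0 < 1 - r^-1 by rewrite subr_gt0 invf_lt1.
  apply: fin_bound; last first.
    by apply: (@hoelder_on_EFin _ _ _ (1 - r^-1)^-1); rewrite ?invr_gt0 ?invrK ?subrKC//.
  by rewrite powR_ge0.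
move=> _ fin_bound; apply: fin_bound; last exact: hoelder_on_y.
exact: Rintegral_ge0.
Qed.

End hoelder_on.

(** * Sharpness and the theorem *)

Section test_functions.
Set Implicit Arguments.
Unset Strict Implicit.
Variable R : realType.
Implicit Types (f g K phi : R -> R) (a b h k l m x M r : R).
Notation mu := (@lebesgue_measure R).

Lemma norm_on_y_le a b phi M : 0 <= M -> (forall x, a <= x <= b -> `|phi x| <= M) ->
  (norm_on a b +oo%E phi <= M%:E)%E.
Proof.
move=> M0 phiM; rewrite /norm_on unlock lebesgue_measureT_gt0.
apply/ess_supP/nearW => x /=; rewrite patchE; case: ifPn => [|_].
  by rewrite inE/= in_itv/= => /phiM; rewrite lee_fin.
by rewrite normr0 lee_fin.
Qed.

(** Two successive primitives, each on a segment one unit shorter at both ends than the previous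
    one. Sharpness can then be tested on [f''] alone. *)
Lemma admissible_of_continuous a b p phi : a < b -> (1 <= p)%E -> continuous phi ->
  exists f f', admissible a b p f f' phi.
Proof.
move=> ab p1 cphi.
have [f' df'] := @continuous_primitive R (a - 2) (b + 2) phi ltac:(lra)
  (continuous_subspaceT cphi).
have cf' : {within `[a - 1, b + 1], continuous f'}.
  apply: continuous_subspace_itv => x; rewrite in_itv/= => /andP[x1 x2].
  by apply: (@is_derive_continuous _ _ _ (phi x)); apply: df'; apply/andP; split; lra.
have [f df] := @continuous_primitive R (a - 1) (b + 1) f' ltac:(lra) cf'.
have dab x : a <= x <= b -> has_deriv_on a b f' x (phi x).
  by move=> /andP[x1 x2]; apply/is_derive_has_deriv_on/df'/andP; split; lra.
have cphiab : {within `[a, b], continuous phi} by exact: continuous_subspaceT.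
have [M M0 HM] := segment_bounded cphiab.
exists f, f'; split.
- move=> x; rewrite in_itv/= => /andP[x1 x2].
  by apply/is_derive_has_deriv_on/df/andP; split; lra.
- apply: (abs_continuous_on_lipschitz M0).
  by apply: (has_deriv_on_lipschitz (f' := phi)) => // x; rewrite in_itv/=; exact: dab.
- have aeF : Filter (nbhs (almost_everywhere mu)) := ae_filter_ringOfSetsType mu.
  by apply: nearW => x; rewrite in_itv/=; exact: dab.
rewrite inE/=; apply/andP; split; rewrite inE/=.
  apply/(measurable_restrictT _ (measurable_itv `[a, b])).
  by have /measurable_int/measurable_EFinP := integrable_continuous cphiab.
rewrite /finite_norm -/(norm_on a b p phi).
case: p p1 => [r| |]//.
  by rewrite lee_fin => r1; rewrite norm_on_continuous ?ltry// (lt_le_trans ltr01).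
by move=> _; apply: le_lt_trans (norm_on_y_le (ltW M0) HM) _; exact: ltry.
Qed.

Lemma Rintegral_gt0 a b phi : a < b -> continuous phi -> (forall x, 0 <= phi x) ->
  0 < phi a -> 0 < \int[mu]_(x in `[a, b]) phi x.
Proof.
move=> ab cphi phi0 pa.
have [F dF] := @continuous_primitive R (a - 1) (b + 1) phi ltac:(lra)
  (continuous_subspaceT cphi).
have dF' x : a <= x <= b -> is_derive x 1 F (phi x).
  by move=> /andP[x1 x2]; apply: dF; apply/andP; split; lra.
rewrite (Rintegral_FTC (ltW ab) dF'); last exact: continuous_subspaceT.
have := cphi a; rewrite /continuous_at => /cvgrPdist_lt /(_ _ pa) /nbhs_ballP[d /= d0 Hd].
(* Within [d] of [a] the function is positive, so the mean value over [[a, c]] is positive as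
   well. *)
pose c := Num.min ((a + b) / 2) (a + d / 2).
have ac : a < c by rewrite lt_min; apply/andP; split; lra.
have cb : c < b by rewrite gt_min; apply/orP; left; lra.
have cd : c < a + d by rewrite gt_min; apply/orP; right; lra.
have [|x /andP[x1 x2] E1] := @is_derive_MVT R a c F phi ac.
  by move=> x /andP[x1 x2]; apply: dF'; apply/andP; split; lra.
have [|y /andP[y1 y2] E2] := @is_derive_MVT R c b F phi cb.
  by move=> y /andP[y1 y2]; apply: dF'; apply/andP; split; lra.
have px : 0 < phi x.
  have := Hd x; rewrite /ball/= ltr0_norm ?subr_lt0// => /(_ ltac:(lra)).
  by have := ler_norm (phi a - phi x); lra.
have -> : F b - F a = (F b - F c) + (F c - F a) by ring.
rewrite E1 E2; apply: ltr_wpDl; last by rewrite mulr_gt0// subr_gt0.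
by rewrite mulr_ge0// subr_ge0 ltW.
Qed.

(** This is the kernel for beta_1 = 2, outside the range [1 < r] of the previous computation. It
    changes sign at [m - h / 2] and [m + h / 2], and is integrated directly on the three pieces. *)
Lemma integral_abs_kernel_1 h m : 0 < h ->
  \int[mu]_(x in `[m - h, m + h]) `|((x - m) ^+ 2 - h ^+ 2 / 4) / 2| = h ^+ 3 / 4.
Proof.
move=> h0; pose P (x : R) : R := ((x - m) ^+ 2 - h ^+ 2 / 4) / 2.
pose u (i : nat) := 
  match i with 0%N => m - h | 1%N => m - h / 2 | 2%N => m + h / 2 | _ => m + h end.
pose Q (x : R) : R := ((x - m) ^+ 3 / 3 - h ^+ 2 / 4 * (x - m)) / 2.
have dQ x : is_derive x 1 Q (P x).
  by rewrite /Q; apply: is_derive_eq; rewrite /P /GRing.scale/=; field.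
have dP x : is_derive x 1 P (x - m).
  by rewrite /P; apply: is_derive_eq; rewrite /GRing.scale/=; field.
have cP : continuous P by move=> x; exact: is_derive_continuous (dP x).
have cnP : continuous (fun x => `|P x|).
  move=> x; apply: (@continuous_comp R R R P (fun y => `|y|)); first exact: cP.
  exact: norm_continuous.
have -> : m - h = u 0%N by [].
have -> : m + h = u 3%N by [].
rewrite (@Rintegral_itv_split R u 3); last 2 first.
- by case=> [|[|[|i]]] /=; lra.
- by apply: integrable_continuous; exact: continuous_subspaceT.
rewrite !big_ord_recl big_ord0/= addr0.
have PE x : P x = (x - (m - h / 2)) * (x - (m + h / 2)) / 2 by rewrite /P; field.
have pos l r : l <= r -> (forall x, l <= x <= r -> 0 <= P x) ->
    \int[mu]_(x in `[l, r]) `|P x| = Q r - Q l.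
  move=> lr P0; rewrite -(Rintegral_FTC lr (fun x _ => dQ x)); last exact: continuous_subspaceT.
  by apply: eq_Rintegral_itv => x /P0 Px; rewrite ger0_norm.
have neg l r : l <= r -> (forall x, l <= x <= r -> P x <= 0) ->
    \int[mu]_(x in `[l, r]) `|P x| = Q l - Q r.
  move=> lr P0.
  have dNQ x : l <= x <= r -> is_derive x 1 (fun x => - Q x) (- P x).
    by move=> _; exact: is_deriveN.
  have -> : Q l - Q r = - Q r - - Q l by ring.
  rewrite -(Rintegral_FTC lr dNQ).
    by apply: eq_Rintegral_itv => x /P0 Px; rewrite ler0_norm.
  by apply: continuous_subspaceT => x; apply: cvgN; exact: cP.
rewrite -/(P _) [X in X + _]pos; last 2 first.
- by lra.
- by move=> x /andP[x1 x2]; rewrite PE divr_ge0// mulr_le0//; lra.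
rewrite [X in _ + (X + _)]neg; last 2 first.
- by lra.
- by move=> x /andP[x1 x2]; rewrite PE ler_pdivrMr// mul0r mulr_ge0_le0//; lra.
rewrite [X in _ + (_ + X)]pos; last 2 first.
- by lra.
- by move=> x /andP[x1 x2]; rewrite PE divr_ge0// mulr_ge0//; lra.
by rewrite /Q; field.
Qed.

End test_functions.

(** * The coefficients as kernel norms, the error bound and its sharpness *)

Section main_estimates.
Set Implicit Arguments.
Unset Strict Implicit.
Variable R : realType.
Variables (a b : R) (n : nat).
Hypotheses (ab : a < b) (n0 : (0 < n)%N).
Implicit Types (f g phi : R -> R) (x k C r : R) (p q : \bar R).
Notation mu := (@lebesgue_measure R).
Let h := (b - a) / (2 * n%:R).
Let nR : 0 < n%:R :> R. Proof. by rewrite ltr0n. Qed.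
Let h0 : 0 < h. Proof. by rewrite divr_gt0 ?subr_gt0 ?mulr_gt0. Qed.

Definition quad_kernel q : R -> R :=
  peano_kernel a ((b - a) / (2 * n%:R)) (((b - a) / (2 * n%:R)) ^+ 2 * beta_const q ^- 2) n.

Lemma continuous_quad_kernel q : continuous (quad_kernel q).
Proof. exact: continuous_peano_kernel. Qed.

Let K_within q : {within `[a, b], continuous (quad_kernel q)}.
Proof. exact: continuous_subspaceT (@continuous_quad_kernel q). Qed.

Lemma quad_errorE p q f f' f'' : (1 <= p)%E -> admissible a b p f f' f'' ->
  quad_error a b q n f f' = \int[mu]_(x in `[a, b]) (quad_kernel q x * f'' x).
Proof.
move=> p1 adm; have if'' := admissible_integrable p1 adm.
by case: adm => df acf' df' _; exact: quad_error_kernel.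
Qed.

Lemma quad_error_le p q f f' f'' C : (1 <= p)%E -> admissible a b p f f' f'' ->
  (measurable_fun `[a, b] f'' ->
   (\int[mu]_(x in `[a, b]) `|quad_kernel q x * f'' x|%:E <= C%:E * norm_on a b p f'')%E) ->
  (`|quad_error a b q n f f'|%:E <= C%:E * norm_on a b p f'')%E.
Proof.
move=> p1 adm H; have if'' := admissible_integrable p1 adm.
have iK := integrable_continuousM (@K_within q) if''.
rewrite (quad_errorE q p1 adm) EFin_normr_Rintegral//.
apply: le_trans (le_abse_integral mu (measurable_itv _) (measurable_int mu iK)) _; apply: H.
by have /measurable_int/measurable_EFinP := if''.
Qed.

(** A competing constant bounds the functional [phi |-> int K phi] on continuous functions, so
    sharpness becomes the duality between the norms of exponents q and p. *)
Lemma sharp_test p q C : (1 <= p)%E ->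
  (forall f f' f'', admissible a b p f f' f'' ->
     (`|quad_error a b q n f f'|%:E <= C%:E * norm_on a b p f'')%E) ->
  forall phi, continuous phi ->
    ((\int[mu]_(x in `[a, b]) (quad_kernel q x * phi x))%:E <= C%:E * norm_on a b p phi)%E.
Proof.
move=> p1 HC phi cphi; have [f [f' adm]] := admissible_of_continuous ab p1 cphi.
apply: le_trans (HC _ _ _ adm); rewrite (quad_errorE q p1 adm) lee_fin.
exact: ler_norm.
Qed.

Lemma error_coef_1 q : error_coef a b 1%E q n = h ^+ 2 / 4.
Proof. by rewrite /error_coef eqxx /h; field; rewrite gt_eqF. Qed.

Lemma quad_node_cover x : a <= x <= b ->
  exists2 i, (i < n)%N & quad_node a b n i <= x <= quad_node a b n i.+1.
Proof.
move=> /andP[ax xb].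
have ex : exists i, x <= quad_node a b n i.+1.
  by exists n.-1; rewrite prednK// quad_noden.
case: (ex_minnP ex) => i xi mini; exists i.
  by rewrite -(prednK n0) ltnS mini// prednK// quad_noden.
rewrite xi andbT; case: i xi mini => [|i] xi mini; first by rewrite quad_node0.
by rewrite leNgt; apply/negP => /ltW/mini; rewrite ltnn.
Qed.

(** For beta = sqrt 2 the kernel [((x - m)^2 - h^2 / 2) / 2] runs from [- h^2 / 4] at a midpoint to
    [h^2 / 4] at a node: the two extremes balance. *)
Lemma quad_kernel_y_le x : a <= x <= b -> `|quad_kernel +oo%E x| <= h ^+ 2 / 4.
Proof.
move=> /quad_node_cover[i ni xi].
rewrite /quad_kernel (peano_kernelE ab n0 _ ni xi) /= sqr_sqrtr//.
rewrite -/h; set m := a + _.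
move: xi; rewrite !quad_nodeE// -[i.+1%:R]natr1 -/h => /andP[x1 x2].
have : (x - m) ^+ 2 <= h ^+ 2.
  rewrite -[leLHS]real_normK ?num_real// ler_sqr ?nnegrE ?(ltW h0)//.
  by rewrite ler_norml /m; apply/andP; split; lra.
by have := sqr_ge0 (x - m); rewrite ler_norml => ? ?; apply/andP; split; lra.
Qed.

Lemma quad_kernel_y_a : quad_kernel +oo%E a = h ^+ 2 / 4.
Proof.
rewrite /quad_kernel (@peano_kernelE _ _ _ _ ab n0 _ 0); last 2 first.
- by [].
- by rewrite quad_node0// lexx quad_node_ge.
by rewrite /= sqr_sqrtr// -/h; field.
Qed.

Lemma error_coef_y : error_coef a b +oo%E 1%E n = \int[mu]_(x in `[a, b]) `|quad_kernel 1%E x|.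
Proof.
rewrite /error_coef /= /quad_kernel /beta_const eqxx -/h.
rewrite (@Rintegral_peano_kernel _ _ _ _ ab n0 _ (fun y => `|y|) (h ^+ 3 / 4)).
- by rewrite /h; field; rewrite gt_eqF.
- exact: norm_continuous.
move=> m; rewrite -(integral_abs_kernel_1 m h0).
have -> : h ^+ 2 * 2 ^- 2 = h ^+ 2 / 4 by field.
by [].
Qed.

Section real_exponent.
Variable r : R.
Hypothesis r1 : 1 < r.
Let r0 : 0 < r. Proof. exact: lt_trans r1. Qed.
Let c := (beta_const r%:E) ^- 2.
(** The value of the kernel at the nodes. *)
Let X := (h ^+ 2 - h ^+ 2 * c) / 2.

Let X0 : 0 < X.
Proof.
have [be1 _] := beta_const_spec r1.
rewrite divr_gt0// subr_gt0 gtr_pMr ?exprn_gt0//.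
by rewrite invf_lt1 ?exprn_gt0 ?exprn_egt1// (lt_trans ltr01).
Qed.

Lemma integral_quad_kernel_powR :
  \int[mu]_(x in `[a, b]) `|quad_kernel r%:E x| `^ r =
  (b - a) / (2 * r + 1) * X `^ r.
Proof.
rewrite /quad_kernel -/h.
rewrite (@Rintegral_peano_kernel _ _ _ _ ab n0 _ (fun y => `|y| `^ r)
  (2 * h / (2 * r + 1) * X `^ r)).
- by rewrite /h; field; rewrite !gt_eqF// addr_gt0// mulr_gt0.
- exact: continuous_abs_powR.
by move=> m; exact: integral_abs_kernel_powR.
Qed.

Lemma integral_quad_kernel_powR_gt0 :
  0 < \int[mu]_(x in `[a, b]) `|quad_kernel r%:E x| `^ r.
Proof.
rewrite integral_quad_kernel_powR mulr_gt0 ?powR_gt0// divr_gt0 ?subr_gt0//.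
by rewrite addr_gt0// mulr_gt0.
Qed.

Lemma error_coef_EFin (t : R) : 1 < t ->
  error_coef a b t%:E r%:E n =
  (\int[mu]_(x in `[a, b]) `|quad_kernel r%:E x| `^ r) `^ r^-1.
Proof.
move=> t1; rewrite integral_quad_kernel_powR /error_coef.
have := X0; rewrite /X /c; move: (beta_const r%:E ^- 2) => e Y0.
rewrite eqe gt_eqF//=.
have ba : 0 < b - a by rewrite subr_gt0.
have r2 : 0 < r + 2^-1 by rewrite addr_gt0.
have r21 : 0 < 2 * r + 1 by rewrite addr_gt0// mulr_gt0.
have powD2 (x s : R) (k : nat) : 0 < x -> x `^ (k%:R + s) = x ^+ k * x `^ s.
  by move=> x0; rewrite powRD ?powR_mulrn ?ltW// (gt_eqF x0) implybT.
rewrite !powD2//.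
set D := (b - a) / (2 * r + 1).
have D0 : 0 < D by rewrite divr_gt0.
rewrite powRM ?powR_ge0 ?(ltW D0)// -powRrM mulfV ?gt_eqF// powRr1 ?(ltW Y0)//.
(* Since [2 r + 1 = 2 (r + 1/2)], the denominator of [D] supplies exactly the two powers that divide
   the coefficient. *)
have -> : (b - a) `^ r^-1 = D `^ r^-1 * (2 `^ r^-1 * (r + 2^-1) `^ r^-1).
  have -> : b - a = D * (2 * (r + 2^-1)) by rewrite /D; field; rewrite gt_eqF.
  by rewrite powRM ?(ltW D0) ?mulr_ge0 ?(ltW r2)// powRM// ltW.
have p2 : 2 `^ r^-1 != 0 :> R by rewrite gt_eqF// powR_gt0.
have p3 : (r + 2^-1) `^ r^-1 != 0 :> R by rewrite gt_eqF// powR_gt0.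
move: (2 `^ r^-1) ((r + 2^-1) `^ r^-1) (D `^ r^-1) p2 p3 => u v w p2 p3.
rewrite /h; field; rewrite p2 p3 gt_eqF//.
Qed.

End real_exponent.

Lemma conjugate_cases p q : (1 <= p)%E -> (p^-1 + q^-1 = 1)%E ->
  [\/ p = 1%E /\ q = +oo%E, p = +oo%E /\ q = 1%E |
   exists t r : R, [/\ p = t%:E, q = r%:E, 1 < t, 1 < r & t^-1 + r^-1 = 1]].
Proof.
move=> p1 pq.
have pN : (-oo < p)%E by rewrite (lt_le_trans _ p1)// ltNyr.
have p0 : (p != 0)%E by rewrite gt_eqF// (lt_le_trans _ p1).
have := (hoelder_conjugateP q pN p0).1 pq.
case: p p1 {pN p0} pq => [t| |]//; last first.
  by move=> _ _; rewrite hoelder_conjugatey => ->; constructor 2.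
rewrite lee_fin le_eqVlt => /predU1P[<- _|t1 pq].
  by rewrite hoelder_conjugate1 => ->; constructor 1.
have t0 : 0 < t by rewrite (lt_trans ltr01).
have t10 : 0 < t - 1 by rewrite subr_gt0.
rewrite /hoelder_conjugate /= !eqe (gt_eqF t0) -EFinD inver (gt_eqF t10) -EFinM => ->.
constructor 3; exists t, (t / (t - 1)); split => //.
  by rewrite ltr_pdivlMr// mul1r ltrBlDr ltrDl.
by field; rewrite !gt_eqF.
Qed.

Lemma quad_error_bound p q f f' f'' : (1 <= p)%E -> (p^-1 + q^-1 = 1)%E ->
  admissible a b p f f' f'' ->
  (`|quad_error a b q n f f'|%:E <= (error_coef a b p q n)%:E * norm_on a b p f'')%E.
Proof.
move=> p1 pq adm; apply: (quad_error_le p1 adm) => mf''.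
case: (conjugate_cases p1 pq) => [[pE qE]|[pE qE]|[t [r [pE qE t1 r1 tr]]]];
    rewrite {}pE {}qE in p1 pq adm *.
- rewrite error_coef_1; apply: hoelder_on_1 => //.
  + by rewrite divr_ge0// sqr_ge0.
  + by move=> x; rewrite in_itv/=; exact: quad_kernel_y_le.
  + by have /measurable_int/measurable_EFinP := integrable_continuous (@K_within +oo%E).
- by rewrite error_coef_y; apply: hoelder_on_y.
- rewrite error_coef_EFin//; apply: hoelder_on_EFin => //.
  + exact: lt_trans t1.
  + exact: lt_trans r1.
Qed.

Lemma sharp_1 C :
  (forall phi, continuous phi ->
    ((\int[mu]_(x in `[a, b]) (quad_kernel +oo%E x * phi x))%:E
      <= C%:E * norm_on a b 1%E phi)%E) ->
  h ^+ 2 / 4 <= C.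
Proof.
move=> HC; apply/ler_addgt0Pr => e e0.
have := @continuous_quad_kernel +oo%E a; rewrite /continuous_at quad_kernel_y_a.
move=> /cvgrPdist_lt /(_ _ e0) /nbhs_ballP[d /= d0 Hd].
(* On [[a, b]] this is a peak at [a] that vanishes beyond [a + d]; wherever it is positive there,
   the kernel exceeds [h ^+ 2 / 4 - e]. *)
pose phi (x : R) := Num.max (d - (x - a)) 0.
have cphi : continuous phi.
  move=> x; apply: (@continuous_max _ _ (fun x : R => d - (x - a)) (fun=> 0)).
    by apply: cvgB; [exact: cvg_cst|apply: cvgB; [exact: cvg_id|exact: cvg_cst]].
  exact: cvg_cst.
have phi0 x : 0 <= phi x by rewrite le_max lexx orbT.
have pa : 0 < phi a by rewrite /phi subrr subr0 lt_max d0.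
have N0 := Rintegral_gt0 ab cphi phi0 pa.
have cphiab : {within `[a, b], continuous phi} by exact: continuous_subspaceT.
have := HC _ cphi; rewrite norm_on_continuous// invr1 powRr1; last first.
  by apply: Rintegral_ge0 => x _; exact: powR_ge0.
rewrite (_ : \int[mu]_(x in `[a, b]) `|phi x| `^ 1 = \int[mu]_(x in `[a, b]) phi x); last first.
  by apply: eq_Rintegral_itv => x _; rewrite powRr1// ger0_norm.
rewrite -EFinM lee_fin => H.
have H2 : \int[mu]_(x in `[a, b]) ((h ^+ 2 / 4 - e) * phi x) <=
          \int[mu]_(x in `[a, b]) (quad_kernel +oo%E x * phi x).
  apply: le_Rintegral => //.
  - apply: (@integrable_continuousM _ _ _ (fun=> h ^+ 2 / 4 - e)).
      by apply: continuous_subspaceT => x; exact: cvg_cst.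
    exact: integrable_continuous.
  - by apply: integrable_continuousM => //; exact: integrable_continuous.
  move=> x; rewrite /= in_itv/= => /andP[ax xb].
  case: (ltP (x - a) d) => xd; last first.
    have -> : phi x = 0 by rewrite /phi (max_idPr _)// subr_le0.
    by rewrite !mulr0.
  apply: ler_wpM2r => //.
  have := Hd x; rewrite /ball/= distrC ger0_norm ?subr_ge0// => /(_ xd)/ltW.
  by rewrite ler_norml => /andP[_]; lra.
rewrite RintegralZl// in H2; last exact: integrable_continuous.
have := le_trans H2 H; rewrite ler_pM2r//; lra.
Qed.

Lemma sharp_y C :
  (forall phi, continuous phi ->
    ((\int[mu]_(x in `[a, b]) (quad_kernel 1%E x * phi x))%:E
      <= C%:E * norm_on a b +oo%E phi)%E) ->
  \int[mu]_(x in `[a, b]) `|quad_kernel 1%E x| <= C.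
Proof.
move=> HC; set K := quad_kernel 1%E in HC *; set L := \int[mu]_(x in _) _.
have cK : continuous K by exact: continuous_quad_kernel.
have L0 : 0 < L.
  rewrite /L -error_coef_y /error_coef /=.
  by rewrite divr_gt0 ?exprn_gt0 ?subr_gt0// mulr_gt0// exprn_gt0.
have cnK : continuous (fun x => `|K x|).
  move=> x; apply: (@continuous_comp R R R K (fun y => `|y|)); first exact: cK.
  exact: norm_continuous.
(* The norm of the test function is only bounded above, by 1, so [C] is replaced by a nonnegative
   constant before multiplying; [L0] removes the maximum at the end. *)
have key e : 0 < e -> L <= Num.max C 0 + e.
  move=> e0; pose d := e / (b - a).
  have d0 : 0 < d by rewrite divr_gt0 ?subr_gt0.
  have Kd x : 0 < `|K x| + d by rewrite ltr_wpDl.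
  pose phi x := K x / (`|K x| + d).
  have cphi : continuous phi.
    move=> x; apply: cvgM; first exact: cK.
    apply: cvgV; first by rewrite gt_eqF.
    by apply: cvgD; [exact: cnK|exact: cvg_cst].
  have phi1 x : `|phi x| <= 1.
    by rewrite /phi normf_div (gtr0_norm (Kd x)) ler_pdivrMr// mul1r lerDl ltW.
  have H1 : \int[mu]_(x in `[a, b]) (`|K x| - d) <= \int[mu]_(x in `[a, b]) (K x * phi x).
    apply: le_Rintegral => //.
    - apply: (@integrable_continuous _ _ _ (fun x => `|K x| - d)).
      apply: continuous_subspaceT => x.
      by apply: cvgB; [exact: cnK|exact: cvg_cst].
    - apply: (@integrable_continuous _ _ _ (fun x => K x * phi x)).
      apply: continuous_subspaceT => x.
      by apply: cvgM; [exact: cK|exact: cphi].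
    (* This is [(|K| - d) (|K| + d) = K^2 - d^2 <= K^2]; the loss [d] integrates to [e] by the
       choice of [d]. *)
    move=> x _; rewrite /phi mulrA -expr2 -[K x ^+ 2]real_normK ?num_real//.
    rewrite ler_pdivlMr//; have := sqr_ge0 d; have := normr_ge0 (K x); nra.
  have H2 : \int[mu]_(x in `[a, b]) (`|K x| - d) = L - e.
    rewrite RintegralB//; last 2 first.
    - by apply: integrable_continuous; exact: continuous_subspaceT.
    - apply: (@integrable_continuous _ _ _ (cst d)).
      by apply: continuous_subspaceT => x; exact: cvg_cst.
    rewrite Rintegral_cst//= lebesgue_measure_itv/= lte_fin ab -EFinD /=.
    by rewrite /d divfK// gt_eqF// subr_gt0.
  have : ((L - e)%:E <= (Num.max C 0)%:E)%E.
    rewrite -H2; apply: le_trans (_ : _ <= (\int[mu]_(x in `[a, b]) (K x * phi x))%:E)%E _.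
      by rewrite lee_fin.
    apply: le_trans (HC _ cphi) _.
    have Nle : (norm_on a b +oo%E phi <= 1)%E by apply: norm_on_y_le.
    have N0 : (0 <= norm_on a b +oo%E phi)%E by exact: Lnorm_ge0.
    apply: (@le_trans _ _ ((Num.max C 0)%:E * norm_on a b +oo%E phi)%E).
      by apply: lee_wpmul2r => //; rewrite lee_fin le_max lexx.
    rewrite -[leRHS]mule1; apply: lee_wpmul2l => //.
    by rewrite lee_fin le_max lexx orbT.
  by rewrite lee_fin; lra.
have : L <= Num.max C 0 by apply/ler_addgt0Pr.
by rewrite le_max => /orP[//|]; rewrite leNgt L0.
Qed.

Lemma sharp_EFin t r C : 1 < t -> 1 < r -> t^-1 + r^-1 = 1 ->
  (forall phi, continuous phi ->
    ((\int[mu]_(x in `[a, b]) (quad_kernel r%:E x * phi x))%:E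
      <= C%:E * norm_on a b t%:E phi)%E) ->
  (\int[mu]_(x in `[a, b]) `|quad_kernel r%:E x| `^ r) `^ r^-1 <= C.
Proof.
move=> t1 r1 tr HC; set K := quad_kernel r%:E in HC *; set S := \int[mu]_(x in _) _.
have S0 : 0 < S by exact: integral_quad_kernel_powR_gt0.
have s0 : 0 < r - 1 by rewrite subr_gt0.
have t0 : 0 < t by exact: lt_trans t1.
have r0 : 0 < r by exact: lt_trans r1.
pose phi x := sgn_powR (r - 1) (K x).
have cphi : continuous phi.
  move=> x; apply: (@continuous_comp R R R K (sgn_powR (r - 1))).
    exact: continuous_quad_kernel.
  exact: continuous_sgn_powR.
have := HC _ cphi; rewrite norm_on_continuous//; last exact: continuous_subspaceT.
have -> : \int[mu]_(x in `[a, b]) (K x * phi x) = S.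
  by apply: eq_Rintegral_itv => x _; rewrite mul_sgn_powR// subrK.
(* Equality case of Hoelder's inequality: [t (r - 1) = r], so [K phi] and [|phi|^t] are both
   [|K|^r]. *)
have -> : \int[mu]_(x in `[a, b]) `|phi x| `^ t = S.
  apply: eq_Rintegral_itv => x _; rewrite abs_sgn_powR// -powRrM; congr (_ `^ _).
  have -> : t = r / (r - 1); last by rewrite mulrC divfK// gt_eqF.
  apply: (can_inj (@invrK R)); have -> : t^-1 = 1 - r^-1 by rewrite -tr addrK.
  by field; rewrite !gt_eqF.
rewrite -EFinM lee_fin => H.
(* The inequality [S <= C S^(1/t)] is divided by [S^(1/t)], which leaves the exponent
   [1 - 1/t = 1/r]. *)
rewrite -(ler_pM2r (powR_gt0 t^-1 S0)) -powRD; last by rewrite (gt_eqF S0) implybT.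
by rewrite addrC tr powRr1// ltW.
Qed.

End main_estimates.

Theorem corollary2p5 (R : realType) (a b : R) (hab : a < b)
    (p q : \bar R) (hp : (1 <= p)%E) (hpq : (p^-1 + q^-1 = 1)%E)
    (n : nat) (hn : (1 <= n)%N) :
  (forall f f' f'' : R -> R, admissible a b p f f' f'' ->
     (`|quad_error a b q n f f'|%:E
        <= (error_coef a b p q n)%:E * norm_on a b p f'')%E)
  /\
  (forall K : R,
     (forall f f' f'' : R -> R, admissible a b p f f' f'' ->
        (`|quad_error a b q n f f'|%:E <= K%:E * norm_on a b p f'')%E) ->
     error_coef a b p q n <= K).
Proof.
split=> [f f' f''|C HC]; first exact: quad_error_bound.
have := sharp_test hab hn hp HC.
case: (conjugate_cases hp hpq) => [[-> ->]|[-> ->]|[t [r [-> -> t1 r1 tr]]]].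
- by rewrite error_coef_1//; exact: sharp_1.
- by rewrite error_coef_y//; exact: sharp_y.
- by rewrite error_coef_EFin//; exact: sharp_EFin.
Qed.
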